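(* Let $k_1,k_2>0$, $h_1,h_2\in\mathbb{R}$, $s_1,s_2>0$, $c_{0,1},c_{0,2}>0$, $\kappa=(k_1^{-1}+k_2^{-1})^{-1/2}$, and let $$\widehat n_{-1}=\begin{pmatrix}-\kappa\\ -s_1\\ 0\end{pmatrix},\quad \widehat n_{-2}=\begin{pmatrix}-\kappa\\ 0\\ -s_2\end{pmatrix},\quad \widehat n_{+1}=\begin{pmatrix}\kappa\\ -s_1\\ 0\end{pmatrix},\quad \widehat n_{+2}=\begin{pmatrix}\kappa\\ 0\\ -s_2\end{pmatrix}.$$ Consider on $[t_0,T]$ the state-dependent sweeping process in $\mathbb{R}^3$ $$-\frac{d}{dt}\begin{pmatrix}\widehat y\\ a_1\\ a_2\end{pmatrix}\in N_{\mathcal{C}_V(t,a)}\begin{pmatrix}\widehat y\\ a_1\\ a_2\end{pmatrix},$$ with the moving set $\mathcal{C}_V(t,\widetilde a)$ of the two-springs system defined in the context. Assume that $l$ is Lipschitz-continuous with $l(t_0)=0$, that $\dot l(t)>0$ and $f_2(t)=0$ a.e. on $[t_0,T]$, and that the initial condition $(\widehat y(t_0),a_1(t_0),a_2(t_0))$ satisfies, at $t=t_0$, $$g_{+1}(t)=0,\quad g_{+2}(t)=0,\qquad g_{-1}(t)<0,\quad g_{-2}(t)<0,$$ where $g_{\pm i}(t)=\pm(\kappa\widehat y(t)+\kappa^2l(t))-s_i(1-h_i)a_i(t)-c_{0,i}$. Then the following solutions are present, as long as $g_{-1}(t)<0$ and $g_{-2}(t)<0$ hold: A. If both $h_1,h_2<1$,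 then there is a single solution, with plastic deformation distributed between both springs, and it is given by $$\begin{pmatrix}\dot{\widehat y}\\ \dot a_1\\ \dot a_2\end{pmatrix}=-\frac{(1-h_2)s_2^2\,\widehat n_{+1}+(1-h_1)s_1^2\,\widehat n_{+2}}{(1-h_1)s_1^2+(1-h_2)s_2^2+(k_1^{-1}+k_2^{-1})(1-h_1)(1-h_2)s_1^2s_2^2}\,\dot l(t)\qquad( * )$$ for a.a. $t\ge t_0$. B. If $h_1=h_2=1$, then there is a continuum of solutions branching at $t_0$ and with derivatives $$\begin{pmatrix}\dot{\widehat y}\\ \dot a_1\\ \dot a_2\end{pmatrix}\in\left\{-\left(\theta\,\widehat n_{+1}+(1-\theta)\,\widehat n_{+2}\right)\dot l(t):\ \theta\in[0,1]\right\}.$$ C. If both $h_1,h_2>1$, then there may be up to three solutions branching at $t_0$, namely: 1. plastic deformation becomes localized in spring 1: $$\begin{pmatrix}\dot{\widehat y}\\ \dot a_1\\ \dot a_2\end{pmatrix}=-\frac{1}{1+(k_1^{-1}+k_2^{-1})(1-h_1)s_1^2}\,\dot l(t)\,\widehat n_{+1},$$ possible if and only if $(k_1^{-1}+k_2^{-1})(1-h_1)s_1^2>-1$; 2. plastic deformation becomes localized in spring 2: $$\begin{pmatrix}\dot{\widehat y}\\ \dot a_1\\ \dot a_2\end{pmatrix}=-\frac{1}{1+(k_1^{-1}+k_2^{-1})(1-h_2)s_2^2}\,\dot l(t)\,\widehat n_{+2},$$ possible if and only if $(k_1^{-1}+k_2^{-1})(1-h_2)s_2^2>-1$; 3. the distributed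 solution $( * )$, which is possible if and only if $$(1-h_1)s_1^2+(1-h_2)s_2^2+(k_1^{-1}+k_2^{-1})(1-h_1)(1-h_2)s_1^2s_2^2<0.$$
   Context: The two-springs system consists of two elasto-plastic springs connected in series, with prescribed total elongation $l(t)$ and prescribed force $f_2(t)$ at the middle node; $a_i$ is the damage (internal) variable of spring $i$. Its moving set is, for $t\in[t_0,T]$ and $\widetilde a=(\widetilde a_1,\widetilde a_2)\in\mathbb{R}^2$, $$\mathcal{C}_V(t,\widetilde a)=\left\{\begin{pmatrix}\widehat y\\ a_1\\ a_2\end{pmatrix}\in\mathbb{R}^3:\ \begin{pmatrix}\widehat n_{-1}^\top\\ \widehat n_{-2}^\top\\ \widehat n_{+1}^\top\\ \widehat n_{+2}^\top\end{pmatrix}\begin{pmatrix}\widehat y+\kappa l(t)\\ a_1-h_1\widetilde a_1\\ a_2-h_2\widetilde a_2\end{pmatrix}+\begin{pmatrix}-k_1\\ k_2\\ k_1\\ -k_2\end{pmatrix}\frac{f_2(t)}{k_1+k_2}\le\begin{pmatrix}c_{0,1}\\ c_{0,2}\\ c_{0,1}\\ c_{0,2}\end{pmatrix}\right\}$$ (component-wise inequality). For a closed convex set $\mathcal{C}\subset\mathbb{R}^3$ and $x\in\mathcal{C}$, $N_{\mathcal{C}}(x)=\{y\in\mathbb{R}^3: y^\top(c-x)\le0\ \text{for all } c\in\mathcal{C}\}$; the inclusion requires $x\in\mathcal{C}$. In the inclusion the moving set is evaluated at $\widetilde a=a(t)=(a_1(t),a_2(t))$, and a solution is an absolutely continuous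 function satisfying the inclusion for a.a. $t$. The conditions $g_{\pm i}(t)=0$ (resp. $<0$) mean that the constraint with normal $\widehat n_{\pm i}$ is active (resp. inactive) at the current state. A dot denotes the time derivative. *)

(* Defs.v *)
From HB Require Import structures.
From mathcomp Require Import all_boot all_order all_algebra.
From mathcomp Require Import all_classical all_reals all_analysis.

Set Implicit Arguments.
Unset Strict Implicit.
Unset Printing Implicit Defensive.

Import Order.TTheory GRing.Theory Num.Theory.
Import numFieldNormedType.Exports.

Local Open Scope classical_set_scope.
Local Open Scope ring_scope.

Section General.
Variable R : realType.

Definition vec3 (x y z : R) : 'cV[R]_3 := \col_i [:: x; y; z]`_i.

Definition vec4 (x y z w : R) : 'cV[R]_4 := \col_i [:: x; y; z; w]`_i.

(* y^T (c - x) is a 1 x 1 matrix, hence the entry 0 0. *)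
Definition normal_cone (n : nat) (C : set 'cV[R]_n) (x : 'cV[R]_n)
    : set 'cV[R]_n :=
  [set y | forall c, C c -> (y^T *m (c - x)) 0 0 <= 0].

(* The intervals of the family may be degenerate and may share end points. *)
Definition absolutely_continuous (V : normedModType R) (a b : R) (u : R -> V) :=
  forall e : R, 0 < e -> exists2 d : R, 0 < d &
    forall (n : nat) (p q : 'I_n -> R),
      (forall i, a <= p i /\ p i <= q i /\ q i <= b) ->
      trivIset setT (fun i => `]p i, q i[%classic) ->
      \sum_(i < n) (q i - p i) < d ->
      \sum_(i < n) `|u (q i) - u (p i)| < e.

End General.

Record two_springs (R : realType) := TwoSprings {
  k1 : R; k2 : R;
  h1 : R; h2 : R;
  s1 : R; s2 : R;
  c01 : R; c02 : R;
  l : R -> R;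
  f2 : R -> R }.

Section TwoSprings.
Variables (R : realType) (S : two_springs R).

(* (k_1^-1 + k_2^-1)^(-1/2) *)
Definition kappa : R := (Num.sqrt ((k1 S)^-1 + (k2 S)^-1))^-1.

(* The normals n_{+i} and n_{-i} are normal_i 1 and normal_i (-1); the same
   convention for the sign e is used for g_{+i} and g_{-i} below. *)
Definition normal1 (e : R) : 'cV[R]_3 := vec3 (e * kappa) (- s1 S) 0.
Definition normal2 (e : R) : 'cV[R]_3 := vec3 (e * kappa) 0 (- s2 S).

Definition normals : 'M[R]_(4, 3) :=
  \matrix_(i < 4)
    ([:: normal1 (-1); normal2 (-1); normal1 1; normal2 1]`_i)^T.

(* Coordinates of the state (y, a_1, a_2). *)
Definition st_y (x : 'cV[R]_3) : R := x 0 0.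
Definition st_a1 (x : 'cV[R]_3) : R := x 1 0.
Definition st_a2 (x : 'cV[R]_3) : R := x 2%:R 0.

Definition moving_set (t : R) (a : R * R) : set 'cV[R]_3 :=
  [set x | forall i : 'I_4,
     (normals *m (vec3 (st_y x + kappa * l S t)
                       (st_a1 x - h1 S * a.1)
                       (st_a2 x - h2 S * a.2))
      + (f2 S t / (k1 S + k2 S)) *: vec4 (- k1 S) (k2 S) (k1 S) (- k2 S)) i 0
     <= vec4 (c01 S) (c02 S) (c01 S) (c02 S) i 0].

Definition g1 (e : R) (t : R) (x : 'cV[R]_3) : R :=
  e * (kappa * st_y x + kappa ^+ 2 * l S t)
  - s1 S * (1 - h1 S) * st_a1 x - c01 S.
Definition g2 (e : R) (t : R) (x : 'cV[R]_3) : R :=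
  e * (kappa * st_y x + kappa ^+ 2 * l S t)
  - s2 S * (1 - h2 S) * st_a2 x - c02 S.

Definition ae_on (a b : R) (P : R -> Prop) : Prop :=
  {ae (@lebesgue_measure R), forall t, t \in `[a, b] -> P t}.

Definition curr_set (t : R) (x : 'cV[R]_3) : set 'cV[R]_3 :=
  moving_set t (st_a1 x, st_a2 x).

Variables (t0 T : R) (u0 : 'cV[R]_3).

Definition ac_from (tau : R) (u : R -> 'cV[R]_3) : Prop :=
  absolutely_continuous t0 tau u /\ u t0 = u0.

(* -u' is in the normal cone of the moving set frozen at the current damage;
   the cone is only meaningful at points of the set, hence the second clause. *)
Definition solution (tau : R) (u : R -> 'cV[R]_3) : Prop :=
  ac_from tau u /\
  ae_on t0 tau (fun t =>
    [/\ derivable u t 1,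
        curr_set t (u t) (u t) &
        normal_cone (curr_set t (u t)) (u t) (- u^`()%classic t)]).

Definition minus_inactive (tau : R) (u : R -> 'cV[R]_3) : Prop :=
  forall t, t \in `[t0, tau] -> g1 (-1) t (u t) < 0 /\ g2 (-1) t (u t) < 0.

Definition valid_solution (tau : R) (u : R -> 'cV[R]_3) : Prop :=
  solution tau u /\ minus_inactive tau u.

(* The derivative of u is of the form l'(t) v with v in V, where v may depend
   on t. *)
Definition rate_in (V : set 'cV[R]_3) (tau : R) (u : R -> 'cV[R]_3) : Prop :=
  ae_on t0 tau (fun t =>
    derivable u t 1 /\ exists2 v, V v & u^`()%classic t = (l S)^`()%classic t *: v).

Definition has_rate (v : 'cV[R]_3) (tau : R) (u : R -> 'cV[R]_3) : Prop :=
  rate_in [set v] tau u.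

(* The function with rate v is defined on the whole of [t0, T], and it solves
   the sweeping process as long as g_{-1} < 0 and g_{-2} < 0, which is the case
   for some time after t0. *)
Definition present (v : 'cV[R]_3) : Prop :=
  exists u, [/\ ac_from T u, has_rate v T u,
    (exists2 tau, t0 < tau <= T & minus_inactive tau u) &
    forall tau, t0 < tau <= T -> minus_inactive tau u -> solution tau u].

(* Weak form of existence: some solution starts with rate v. *)
Definition possible (v : 'cV[R]_3) : Prop :=
  exists tau u, [/\ t0 < tau <= T, valid_solution tau u & has_rate v tau u].

(* Since present implies possible, both are equivalent to P. *)
Definition present_iff (v : 'cV[R]_3) (P : Prop) : Prop :=
  (P -> present v) /\ (possible v -> P).

(* Solutions with the rates v and w, if any, separate immediately after t0. *)
Definition branch_at_start (v w : 'cV[R]_3) : Prop :=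
  forall tau u x, t0 < tau <= T ->
    valid_solution tau u -> has_rate v tau u ->
    valid_solution tau x -> has_rate w tau x ->
    forall t, t0 < t <= tau -> u t <> x t.

Definition distributed_den : R :=
  (1 - h1 S) * s1 S ^+ 2 + (1 - h2 S) * s2 S ^+ 2
  + ((k1 S)^-1 + (k2 S)^-1) * (1 - h1 S) * (1 - h2 S) * s1 S ^+ 2 * s2 S ^+ 2.

Definition distributed_rate : 'cV[R]_3 :=
  - (distributed_den^-1 *: (((1 - h2 S) * s2 S ^+ 2) *: normal1 1
                            + ((1 - h1 S) * s1 S ^+ 2) *: normal2 1)).

Definition localized_rate1 : 'cV[R]_3 :=
  - ((1 + ((k1 S)^-1 + (k2 S)^-1) * (1 - h1 S) * s1 S ^+ 2)^-1 *: normal1 1).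

Definition localized_rate2 : 'cV[R]_3 :=
  - ((1 + ((k1 S)^-1 + (k2 S)^-1) * (1 - h2 S) * s2 S ^+ 2)^-1 *: normal2 1).

Definition mixed_rate (theta : R) : 'cV[R]_3 :=
  - (theta *: normal1 1 + (1 - theta) *: normal2 1).

End TwoSprings.

(* Main.v *)
(** Away from the constraints n_{-1} and n_{-2}, an element of the normal cone
    is L1 n_{+1} + L2 n_{+2} with multipliers L1, L2 >= 0 that vanish on
    inactive constraints.  With K = 1/k_1 + 1/k_2 and H_i = (1 - h_i) s_i^2 the
    gaps G_i = g_{+i}(t, u(t)) <= 0 thus satisfy, almost everywhere,
      K G_i' = l' - (L1 + L2) - K H_i L_i,
    and G_i' = 0 wherever G_i = 0, since there G_i is at its maximum.
    - If H_1, H_2 >= 0, both gaps are nondecreasing and start from 0, hence stay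
      at 0; this determines L1 and L2 when H_i > 0, and only L1 + L2 = l' when
      H_i = 0.
    - If H_1, H_2 < 0, both gaps increase whenever both are negative, so that
      one of them is always 0; then both are nonincreasing.  Therefore one gap
      vanishes identically, and the other one either leaves 0 immediately
      (localization) or stays at 0 for some time (distributed deformation).
    Monotonicity is inferred from the sign of an almost everywhere derivative
    of an absolutely continuous function by advancing along the interval: at a
    point outside the exceptional null set the derivative controls the
    increment, at the other points one uses an interval of an open set of small
    measure that covers the null set. *)

Require Import Defs.
From HB Require Import structures.
From mathcomp Require Import all_boot all_order all_algebra.
From mathcomp Require Import all_classical all_reals all_analysis.
From mathcomp Require Import ring lra.

Set Implicit Arguments.
Unset Strict Implicit.
Unset Printing Implicit Defensive.

Import Order.TTheory GRing.Theory Num.Theory.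
Import numFieldNormedType.Exports.

Local Open Scope classical_set_scope.
Local Open Scope ring_scope.

(** * Monotonicity of absolutely continuous functions from the sign of their derivative *)

Section Monotonicity.
Variable R : realType.
Implicit Types (f : R -> R) (a b t s : R) (P : R -> Prop).

(** Induction along a real interval: the supremum of the points satisfying [P] is reached from a
    point just before it, and unless it is [b], the same step leads beyond it. The step only joins
    points on the two sides of [s], which is where derivative estimates at [s] apply. *)
Lemma creeping P a b : a <= b -> P a ->
  (forall s, a <= s <= b -> exists2 r : R, 0 < r & forall t t',
     s - r < t <= s -> s <= t' < s + r -> a <= t -> t' <= b -> P t -> P t') ->
  P b.
Proof.
move=> ab Pa step.
pose A := [set t | a <= t <= b /\ P t].
have Aa : A a by split; rewrite ?lexx.
have ubA : ubound A b by move=> t [/andP[_ ->]].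
have supA : has_sup A by split; [exists a|exists b].
have sa : a <= sup A by apply: ub_le_sup; first exists b.
have sb : sup A <= b by apply: ge_sup => //; exists a.
have [r r0 Pr] := step (sup A) (introT andP (conj sa sb)).
have [t [/andP[at_ tb] Pt] tr] := sup_adherent r0 supA.
have ts : t <= sup A by apply: ub_le_sup; [exists b|split; rewrite ?at_ ?tb].
have reach t' : sup A <= t' < sup A + r -> t' <= b -> P t'.
  by move=> t's t'b; apply: (Pr t) => //; rewrite tr ts.
have [->|sltb] := eqVneq b (sup A); first by apply: reach; lra.
pose t' := Num.min b (sup A + r / 2).
have sb' : sup A < b by rewrite lt_neqAle eq_sym sltb.
have t'b : t' <= b by rewrite /t' ge_min lexx.
have st' : sup A < t' by rewrite /t' lt_min sb' /=; lra.
have : t' <= sup A.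
  apply: ub_le_sup; first by exists b.
  split; first by rewrite t'b andbT; lra.
  apply: reach => //; rewrite (ltW st') /= /t' gt_min; apply/orP; right; lra.
by rewrite leNgt st'.
Qed.

(** Endpoints are indexed by [nat], not by ordinals, so that appending an interval on the right is a
    mere test on the index. *)
Definition chain (U : set R) a t n (p q : nat -> R) :=
  [/\ forall i, (i < n)%N -> a <= p i /\ p i <= q i /\ q i <= t,
      forall i j, (i < j < n)%N -> q i <= p j &
      forall i, (i < n)%N -> `[p i, q i] `<=` U].

Lemma chain_trivIset U a t n (p q : nat -> R) : chain U a t n p q ->
  trivIset setT (fun i : 'I_n => `]p i, q i[%classic).
Proof.
move=> [_ ord _]; apply/trivIsetP => i j _ _ ij.
apply/seteqP; split=> // x []; rewrite /= !in_itv /= => /andP[pi qi] /andP[pj qj].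
have [ltij|ltji|eij] := ltngtP i j.
- by have := ord i j; rewrite ltij ltn_ord => /(_ isT); lra.
- by have := ord j i; rewrite ltji ltn_ord => /(_ isT); lra.
- by move: ij; rewrite (val_inj eij) eqxx.
Qed.

(** The open intervals are disjoint and lie in [U], so their total length is the measure of a subset
    of [U]. *)
Lemma chain_length U a t n (p q : nat -> R) (d : R) :
  open U -> (lebesgue_measure U < d%:E)%E -> chain U a t n p q ->
  \sum_(i < n) (q i - p i) < d.
Proof.
move=> oU Ud ch; have [le_pq _ sub] := ch.
rewrite -lte_fin; apply: le_lt_trans Ud; rewrite -sumEFin.
have mI (i : 'I_n) : measurable (`]p i, q i[%classic : set R) by exact: measurable_itv.
have -> : (\sum_(i < n) (q i - p i)%:E)%E =
          (\sum_(i < n) lebesgue_measure (`]p i, q i[%classic : set R))%E.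
  apply: eq_bigr => i _; rewrite lebesgue_measure_itv /= lte_fin EFinB.
  have [//|qp] := ltP (p i) (q i).
  have [_ [pq _]] := le_pq i (ltn_ord i).
  by rewrite (@le_anti _ _ (p i) (q i)) ?pq ?qp// -EFinB subrr.
rewrite -measure_bigsetU_ord //; last exact: chain_trivIset ch.
rewrite -(bigcup_mkord n (fun i => `]p i, q i[%classic)).
apply: le_measure; rewrite ?inE.
- by apply: bigcup_measurable => i _; exact: measurable_itv.
- exact: measurable_realfun.open_measurable.
move=> x [i /= ltin]; rewrite in_itv /= => /andP[px xq].
by apply: (sub i ltin); rewrite /= in_itv /= !ltW.
Qed.

Lemma chain_le U a t t' n p q : t <= t' -> chain U a t n p q -> chain U a t' n p q.
Proof.
move=> tt' [c1 c2 c3]; split=> // i /c1 [? [? ?]]; do 2 split => //.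
exact: le_trans tt'.
Qed.

Lemma chain_rcons U a t t' n p q : a <= t -> t <= t' -> `[t, t'] `<=` U ->
  chain U a t n p q ->
  chain U a t' n.+1 (fun i => if (i < n)%N then p i else t)
                    (fun i => if (i < n)%N then q i else t').
Proof.
move=> at_ tt' sub [c1 c2 c3]; split.
- move=> i _; case: ifP => [/c1 [? [? ?]]|_]; last by rewrite lexx.
  by do 2 split => //; exact: le_trans tt'.
- move=> i j /andP[ij]; rewrite ltnS => jn.
  rewrite (leq_trans ij jn); have [ltjn|_] := ltnP j n.
    by apply: c2; rewrite ij.
  by have [_ [_ ->]] := c1 i (leq_trans ij jn).
- by move=> i _; case: ifP => // /c3.
Qed.

(** First-order expansion at [s]; clearing the difference quotient makes [x = s] admissible. *)
Lemma derivable_growth f s (e : R) : derivable f s 1 -> 0 < e ->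
  exists2 r : R, 0 < r & forall x, `|x - s| < r ->
    `|f x - f s - f^`()%classic s * (x - s)| <= e * `|x - s|.
Proof.
move=> fs e0; have := derivableP fs => -[_ D].
move: fs => /cvg_ex[l /= cl].
have El : f^`()%classic s = l by rewrite derive1E /derive; apply/cvg_lim.
move/cvgrPdist_le : cl => /(_ e e0) /nbhs_ballP [r /= r0 br].
exists r => // x xr; have [->|xs] := eqVneq x s.
  by rewrite !subrr mulr0 subrr normr0 mulr0.
have xs0 : x - s != 0 by rewrite subr_eq0.
have := br (x - s); rewrite /ball /= sub0r normrN => /(_ xr xs0).
rewrite /= [_%:A]mulr1 subrK => H.
rewrite -ler_pdivrMr ?normr_gt0// -normf_div El.
suff -> : (f x - f s - l * (x - s)) / (x - s) = - (l - (x - s)^-1 *: (f x - f s)).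
  by rewrite normrN.
by rewrite /GRing.scale /=; field.
Qed.

Lemma ac_nondecreasing f a b : a <= b -> absolutely_continuous a b f ->
  ae_on a b (fun t => derivable f t 1 /\ 0 <= f^`()%classic t) -> f a <= f b.
Proof.
move=> ab ac [N [mN N0 subN]].
(* The loss [e * (b - a)] comes from the points where the derivative is used, the loss [e] from the
   intervals covering the null set. *)
suff main e : 0 < e -> f a - e * (b - a) - e <= f b.
  apply/ler_addgt0Pr => e e0.
  have ba : 0 <= b - a by rewrite subr_ge0.
  (* With this tolerance the two losses add up to exactly [e]; the summand 1 covers [a = b]. *)
  have e0' : 0 < e / (b - a + 1) by apply: divr_gt0 => //; lra.
  have := main _ e0'.
  have -> : f a - e / (b - a + 1) * (b - a) - e / (b - a + 1) = f a - e.
    by field; lra.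
  by rewrite lerBlDr.
move=> e0; have [d d0 acd] := ac e e0.
have [U [oU NU UN]] : exists U : set R, [/\ open U, N `<=` U &
    (lebesgue_measure (U `\` N) < d%:E)%E].
  by apply: lebesgue_regularity_outer => //; rewrite [X in (X < _)%E]N0 ltry.
have mU := measurable_realfun.open_measurable oU.
have Ud : (lebesgue_measure U < d%:E)%E.
  apply: le_lt_trans UN; rewrite -(setDUK NU).
  rewrite (le_trans (measureU2 _ _ _))//; first exact: measurableD.
  by rewrite setDUK// [X in (X + _)%E]N0 add0e.
(* The property carried along: up to [t] the decrease is at most [e] per unit length plus the
   increments over a chain inside [U]. *)
pose P t := exists n p q, chain U a t n p q /\
  f a - e * (t - a) - \sum_(i < n) `|f (q i) - f (p i)| <= f t.
have : P b.
  apply: (@creeping P a b ab).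
    exists 0%N, (fun=> 0), (fun=> 0); split; first by split=> // i [].
    by rewrite big_ord0 !subrr mulr0 !subr0.
  (* Near a point of [U] the whole interval from [t] to [t'] is charged to the chain. *)
  move=> s sab; have [Us|nUs] := pselect (U s).
    have /nbhs_ballP [r /= r0 br] : nbhs s U by apply: open_nbhs_nbhs.
    exists r => // t t' /andP[st ts] /andP[st' ts'] at_ t'b [n [p [q [ch le]]]].
    exists n.+1, (fun i => if (i < n)%N then p i else t),
       (fun i => if (i < n)%N then q i else t'); split.
      apply: chain_rcons => //; first lra.
      move=> x; rewrite /= in_itv /= => /andP[tx xt']; apply: br.
      by rewrite /ball /= ltr_norml; lra.
    rewrite big_ord_recr /= ltnn.
    under eq_bigr do rewrite ltn_ord.
    have := ler_norm (f t - f t'); rewrite distrC.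
    have : 0 <= e * (t' - t) by apply: mulr_ge0; lra.
    have -> : e * (t' - a) = e * (t' - t) + e * (t - a) by ring.
    by lra.
  (* Outside [U] the derivative exists and is nonnegative; the increments from [t] to [s] and from
     [s] to [t'] are estimated separately and the chain is unchanged. *)
  have [fs fs0] : derivable f s 1 /\ 0 <= f^`()%classic s.
    apply: contrapT => nd; apply/nUs/NU/subN => /= H; apply: nd; apply: H.
    by rewrite in_itv.
  have [r r0 br] := derivable_growth fs e0.
  exists r => // t t' /andP[st ts] /andP[st' ts'] at_ t'b [n [p [q [ch le]]]].
  exists n, p, q; split; first by apply: chain_le ch; lra.
  have := br t; have := br t'.
  rewrite (@ger0_norm _ (t' - s)) ?subr_ge0// (@ler0_norm _ (t - s)) ?subr_le0//.
  have -> : t' - s < r by lra.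
  have -> : - (t - s) < r by lra.
  move=> /(_ isT) + /(_ isT); rewrite !ler_norml => /andP[H1 _] /andP[_ H2].
  have : 0 <= f^`()%classic s * (t' - s) by apply: mulr_ge0; lra.
  have : 0 <= f^`()%classic s * (s - t) by apply: mulr_ge0; lra.
  by nra.
(* The chain is shorter than [d], so absolute continuity bounds its increments by [e]. *)
move=> [n [p [q [ch le]]]]; apply: le_trans le; rewrite lerD2l lerN2.
apply/ltW/acd.
- by move=> i; case: ch => /(_ i (ltn_ord i)).
- exact: chain_trivIset ch.
- exact: chain_length ch.
Qed.

End Monotonicity.

(** * Properties holding almost everywhere on an interval *)

Section AlmostEverywhere.
Variable R : realType.
Implicit Types (f g : R -> R) (a b : R) (P Q : R -> Prop).

Let ae_filter := ae_filter_ringOfSetsType (@lebesgue_measure R).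

Lemma ae_onS a b P Q : (forall t, t \in `[a, b] -> P t -> Q t) ->
  ae_on a b P -> ae_on a b Q.
Proof.
by move=> PQ; apply: (@filterS _ _ ae_filter) => t Pt tab; apply: PQ (Pt tab).
Qed.

Lemma ae_onI a b P Q : ae_on a b P -> ae_on a b Q ->
  ae_on a b (fun t => P t /\ Q t).
Proof. by apply: (@filterS2 _ _ ae_filter) => t Pt Qt tab; split; auto. Qed.

Lemma ae_on_sub a b a' b' P : a <= a' -> b' <= b ->
  ae_on a b P -> ae_on a' b' P.
Proof.
move=> aa' b'b; apply: (@filterS _ _ ae_filter) => t Pt; rewrite in_itv /= => /andP[ta tb].
by apply: Pt; rewrite in_itv /=; lra.
Qed.

Lemma ae_on_oo a b : ae_on a b (fun t => a < t < b).
Proof.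
exists ([set a] `|` [set b]); split.
- by apply: measurableU; exact: measurable_set1.
- apply/eqP; rewrite eq_le measure_ge0 andbT.
  apply: le_trans (measureU2 _ _ _) _; try exact: measurable_set1.
  by rewrite [X in (X + _)%E]lebesgue_measure_set1 add0e [X in (X <= _)%E]lebesgue_measure_set1.
move=> t /=; rewrite in_itv /= => /not_implyP[/andP[at_ tb] /negP].
rewrite negb_and -!leNgt => /orP[ta|bt]; [left|right]; apply/eqP; rewrite eq_le.
  by rewrite ta at_.
by rewrite bt tb.
Qed.

(** The open interval has positive measure, so a null set cannot contain it. *)
Lemma ae_on_ex a b P : a < b -> ae_on a b P -> exists t, a < t < b /\ P t.
Proof.
move=> ab aeP; have [N [mN N0 sub]] := ae_onI (ae_on_oo a b) aeP.
apply: contrapT => nP.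
suff : (lebesgue_measure (`]a, b[%classic : set R) <= lebesgue_measure (N : set R))%E.
  by rewrite lebesgue_measure_itv /= lte_fin ab [X in (_ <= X)%E]N0 -EFinB lee_fin; lra.
apply: le_measure; rewrite ?inE //.
move=> t /=; rewrite in_itv /= => tab; apply: sub => /= H; apply: nP.
exists t; apply: H; rewrite in_itv /=; lra.
Qed.

End AlmostEverywhere.

(** * Closure properties and consequences of absolute continuity *)

Section AbsoluteContinuity.
Variable R : realType.
Implicit Types (f g : R -> R) (a b : R).

Lemma ac_sub (V : normedModType R) (u : R -> V) a b a' b' : a <= a' -> b' <= b ->
  absolutely_continuous a b u -> absolutely_continuous a' b' u.
Proof.
move=> aa' b'b ac e /ac [d d0 H]; exists d => // n p q Hpq; apply: H => i.
by have [? [? ?]] := Hpq i; do ?split => //; lra.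
Qed.

(** Common source of several closure properties below: a bound on increments transfers the modulus.
    The constant [|k| + 1] is positive, hence a legitimate divisor. *)
Lemma ac_dominated (V W : normedModType R) (k : R) a b (u : R -> V) (w : R -> W) :
  (forall s t, s \in `[a, b] -> t \in `[a, b] -> `|w t - w s| <= k * `|u t - u s|) ->
  absolutely_continuous a b u -> absolutely_continuous a b w.
Proof.
move=> dom ac e e0; pose k' := `|k| + 1.
have k'0 : 0 < k' by rewrite /k'; have := normr_ge0 k; lra.
have [d d0 H] := ac _ (divr_gt0 e0 k'0); exists d => // n p q Hpq tri len.
have := H n p q Hpq tri len; rewrite ltr_pdivlMr// => H'.
apply: le_lt_trans H'; rewrite mulrC mulr_sumr; apply: ler_sum => i _.
have [? [? ?]] := Hpq i.
apply: le_trans (dom _ _ _ _) _; rewrite ?in_itv /=; try lra.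
by rewrite ler_wpM2r// /k'; have := ler_norm k; lra.
Qed.

Lemma ac_id a b : absolutely_continuous a b (id : R -> R).
Proof.
move=> e e0; exists e => // n p q Hpq _; apply: le_lt_trans.
by apply: ler_sum => i _; have [? [? ?]] := Hpq i; rewrite ger0_norm ?subr_ge0.
Qed.

Lemma acD (V : normedModType R) (u w : R -> V) a b :
  absolutely_continuous a b u -> absolutely_continuous a b w ->
  absolutely_continuous a b (fun t => u t + w t).
Proof.
move=> acu acw e e0; have e2 : 0 < e / 2 by lra.
have [d d0 Hu] := acu _ e2; have [d' d'0 Hw] := acw _ e2.
exists (Num.min d d'); first by rewrite lt_min d0.
move=> n p q Hpq tri; rewrite lt_min => /andP[lu lw].
have := Hu n p q Hpq tri lu; have := Hw n p q Hpq tri lw => Bw Bu.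
apply: (@le_lt_trans _ _ (\sum_(i < n) (`|u (q i) - u (p i)| + `|w (q i) - w (p i)|))).
  apply: ler_sum => i _; rewrite opprD addrACA; exact: ler_normD.
by rewrite big_split /=; lra.
Qed.

Lemma acZ (V : normedModType R) (u : R -> V) (k : R) a b :
  absolutely_continuous a b u -> absolutely_continuous a b (fun t => k *: u t).
Proof.
by apply: (@ac_dominated _ _ `|k|) => s t _ _; rewrite -scalerBr normrZ.
Qed.

Lemma ac_cst (V : normedModType R) (v : V) a b :
  absolutely_continuous a b (fun=> v).
Proof.
apply: (@ac_dominated _ _ 0 _ _ (id : R -> R)); last exact: ac_id.
by move=> s t _ _; rewrite subrr normr0 mul0r.
Qed.

Lemma ac_max f g a b :
  absolutely_continuous a b f -> absolutely_continuous a b g ->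
  absolutely_continuous a b (fun t => Num.max (f t) (g t)).
Proof.
move=> acf acg.
have -> : (fun t => Num.max (f t) (g t)) =
    (fun t => 2^-1 *: ((f t + g t) + `|f t + (-1) *: g t|)).
  apply/funext => t; rewrite /GRing.scale /= mulN1r.
  have [fg|gf] := leP (f t) (g t).
    by rewrite ler0_norm; lra.
  by rewrite ger0_norm; lra.
apply/acZ/acD; first exact: acD.
apply: (@ac_dominated _ _ 1 _ _ (fun t => f t + (-1) *: g t)).
  by move=> s t _ _; rewrite mul1r; exact: ler_dist_dist.
by apply/acD => //; exact: acZ.
Qed.

Lemma ac_entry m n (u : R -> 'M[R]_(m.+1, n.+1)) a b i j :
  absolutely_continuous a b u -> absolutely_continuous a b (fun t => u t i j).
Proof.
apply: (@ac_dominated _ _ 1) => s t _ _; rewrite mul1r.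
have -> : u t i j - u s i j = (u t - u s) i j by rewrite !mxE.
rewrite [leRHS]/Num.Def.normr/= mx_normrE.
exact: (le_bigmax _ (fun ij => `|(u t - u s) ij.1 ij.2|) (i, j)).
Qed.

Lemma ac_lipschitz f a b :
  [lipschitz f t | t in `[a, b]] -> absolutely_continuous a b f.
Proof.
move=> [M [Mr H]].
(* The Lipschitz property is stated for all constants larger than [M], hence [M + 1]. *)
apply: (@ac_dominated _ _ (M + 1) _ _ (id : R -> R)); last exact: ac_id.
by move=> s t sab tab; apply: (H (M + 1) _ (t, s)) => //; lra.
Qed.

(** Families consisting of a single interval give uniform continuity. *)
Lemma ac_unif (V : normedModType R) (u : R -> V) a b (e : R) :
  absolutely_continuous a b u -> 0 < e ->
  exists2 d, 0 < d & forall s t, s \in `[a, b] -> t \in `[a, b] ->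
    `|t - s| < d -> `|u t - u s| < e.
Proof.
move=> ac e0; have [d d0 H] := ac e e0; exists d => // s t.
wlog st : s t / s <= t.
  move=> W sab tab; have [?|/ltW ?] := leP s t; first exact: W.
  rewrite (distrC t) (distrC (u t)); exact: W.
rewrite !in_itv /= => /andP[as_ sb] /andP[at_ tb]; rewrite ger0_norm ?subr_ge0// => std.
have := H 1%N (fun=> s) (fun=> t); rewrite !big_ord1; apply=> //.
by apply/trivIsetP => i j _ _; rewrite !ord1 eqxx.
Qed.

(** By continuity a positive value would persist on an interval of positive measure. *)
Lemma ac_le0 f a b : a < b -> absolutely_continuous a b f ->
  ae_on a b (fun t => f t <= 0) -> {in `[a, b], forall t, f t <= 0}.
Proof.
move=> ab ac ae t tab; rewrite leNgt; apply/negP => ft.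
have [d d0 H] := ac_unif ac ft.
move: tab (tab); rewrite {1}in_itv /= => /andP[at_ tb] tab.
pose a' := Num.max a (t - d / 2); pose b' := Num.min b (t + d / 2).
have [s [/andP[sa sb] fs]] : exists s, a' < s < b' /\ f s <= 0.
  apply: ae_on_ex; last first.
    by apply: ae_on_sub ae; rewrite ?le_max ?ge_min lexx.
  by rewrite lt_min !gt_max; lra.
move: sa sb; rewrite lt_min gt_max => /andP[as_ ts] /andP[sb st].
have sab : s \in `[a, b] by rewrite in_itv /=; lra.
have std : `|s - t| < d by rewrite ltr_norml; lra.
by have := H t s tab sab std; rewrite distrC; have := ler_norm (f t - f s); lra.
Qed.

(** The last time at which [f] is nonnegative: by continuity the supremum of such times is one of
    them. *)
Lemma ac_last_nonneg f a b : a <= b -> absolutely_continuous a b f ->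
  0 <= f a -> f b < 0 ->
  exists2 s, a <= s < b & 0 <= f s /\ forall t, s < t <= b -> f t < 0.
Proof.
move=> ab ac fa fb; pose A := [set t | a <= t <= b /\ 0 <= f t].
have Aa : A a by split; rewrite ?lexx.
have supA : has_sup A by split; [exists a|exists b => t [/andP[]]].
have sa : a <= sup A by apply: ub_le_sup; [case: supA|].
have sb : sup A <= b by apply: ge_sup => [|t [/andP[]]//]; exists a.
have fs : 0 <= f (sup A).
  rewrite leNgt; apply/negP => fs; have fs' : 0 < - f (sup A) by lra.
  have [d d0 H] := ac_unif ac fs'.
  have [t [/andP[at_ tb] ft] tr] := sup_adherent d0 supA.
  have ts : t <= sup A by apply: ub_le_sup; [case: supA|split; rewrite ?at_ ?tb].
  have := H (sup A) t; rewrite !in_itv /= => /(_ _ _ _) Hd.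
  suff : `|f t - f (sup A)| < - f (sup A) by have := ler_norm (f t - f (sup A)); lra.
  by apply: Hd; rewrite ?sa ?sb ?at_ ?tb// ltr_norml; lra.
exists (sup A); last split=> // t /andP[st tb].
  rewrite sa lt_neqAle sb andbT; apply/eqP => E; move: fs; rewrite E; lra.
rewrite ltNge; apply/negP => ft; suff : t <= sup A by lra.
by apply: ub_le_sup; [case: supA|split=> //; lra].
Qed.

Lemma ac_nonincreasing f a b : a <= b -> absolutely_continuous a b f ->
  ae_on a b (fun t => derivable f t 1 /\ f^`()%classic t <= 0) -> f b <= f a.
Proof.
move=> ab /(acZ (-1)) acN ae; rewrite -lerN2 -![- f _]mulN1r.
apply: (ac_nondecreasing ab acN); apply: ae_onS ae => t _ [ft ft0].
split; first exact: derivableZ.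
by rewrite derive1E deriveZ// -derive1E /GRing.scale /= mulN1r; lra.
Qed.

Lemma ac_constant f a b : absolutely_continuous a b f ->
  ae_on a b (fun t => derivable f t 1 /\ f^`()%classic t = 0) ->
  {in `[a, b], forall t, f t = f a}.
Proof.
move=> ac ae t; rewrite in_itv /= => /andP[at_ tb].
have act := ac_sub (lexx a) tb ac; have aet := ae_on_sub (lexx a) tb ae.
apply/eqP; rewrite eq_le (ac_nonincreasing at_ act) ?(ac_nondecreasing at_ act)//;
  by apply: ae_onS aet => s _ [fs ->].
Qed.

(** Fermat's rule: with tolerance [|D| / 2] the linear term wins, so a small step in the direction
    of the sign of [D] would raise [f] above its maximum. *)
Lemma derivable_at_max f a b t : (forall s, a < s < b -> f s <= f t) ->
  a < t < b -> derivable f t 1 -> f^`()%classic t = 0.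
Proof.
move=> fmax tab ft; apply/eqP/negP => /negP nz; set D := f^`()%classic t in nz *.
have D0 : 0 < `|D| / 2 by rewrite divr_gt0 ?normr_gt0.
have [r r0 br] := derivable_growth ft D0.
pose h := Num.min (r / 2) (Num.min ((t - a) / 2) ((b - t) / 2)).
have /andP[at_ tb] := tab.
have h0 : 0 < h by rewrite !lt_min; lra.
have [hr ha hb] : [/\ h < r, h < t - a & h < b - t].
  by rewrite !gt_min; split; lra.
have [Dp|Dn] := ltP 0 D.
  have := br (t + h); have := fmax (t + h).
  rewrite -/D addrAC subrr add0r (gtr0_norm h0) (gtr0_norm Dp) => le /(_ hr).
  by rewrite ler_norml => /andP[lo _]; have := mulr_gt0 Dp h0; lra.
have Dn' : D < 0 by rewrite lt_neqAle nz.
have := br (t - h); have := fmax (t - h).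
rewrite -/D addrAC subrr add0r normrN (gtr0_norm h0) (ltr0_norm Dn') => le /(_ hr).
by rewrite ler_norml => /andP[lo _]; have := nmulr_llt0 h Dn'; rewrite h0 => /idP; lra.
Qed.

End AbsoluteContinuity.

(** * The two gap functions under hardening and under softening *)

Section GapDynamics.
Variable R : realType.
Implicit Types (a b c K H : R) (dl G L : R -> R).

(* Rates of the two gap functions along -u' = L1 n_{+1} + L2 n_{+2}, with
   K = 1/k_1 + 1/k_2 and H_i = (1 - h_i) s_i^2. *)
Definition gap_dynamics K H1 H2 a b dl G1 G2 L1 L2 : Prop :=
  [/\ absolutely_continuous a b G1, absolutely_continuous a b G2 &
  ae_on a b (fun t => [/\ 0 < dl t,
    [/\ derivable G1 t 1, K * G1^`()%classic t = dl t - (L1 t + L2 t) - K * H1 * L1 t,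
        0 <= L1 t, G1 t <= 0 & G1 t < 0 -> L1 t = 0] &
    [/\ derivable G2 t 1, K * G2^`()%classic t = dl t - (L1 t + L2 t) - K * H2 * L2 t,
        0 <= L2 t, G2 t <= 0 & G2 t < 0 -> L2 t = 0]])].

(** Exchange of the two springs, so that arguments need to be made for the first gap only. *)
Lemma gap_dynamicsC K H1 H2 a b dl G1 G2 L1 L2 :
  gap_dynamics K H1 H2 a b dl G1 G2 L1 L2 -> gap_dynamics K H2 H1 a b dl G2 G1 L2 L1.
Proof.
by case=> ac1 ac2 ae; split=> //; apply: ae_onS ae => t _; rewrite (addrC (L1 t)); case.
Qed.

Lemma gap_dynamics_le0 K H1 H2 a b dl G1 G2 L1 L2 : a < b ->
  gap_dynamics K H1 H2 a b dl G1 G2 L1 L2 -> {in `[a, b], forall t, G1 t <= 0}.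
Proof.
by move=> ab [ac1 _ ae]; apply: ac_le0 => //; apply: ae_onS ae => t _ [_ []].
Qed.

Lemma gap_dynamics_stationary K H1 H2 a b dl G1 G2 L1 L2 : a < b ->
  gap_dynamics K H1 H2 a b dl G1 G2 L1 L2 ->
  ae_on a b (fun t => G1 t = 0 -> G1^`()%classic t = 0).
Proof.
move=> ab dyn; have le0 := gap_dynamics_le0 ab dyn; case: dyn => _ _ ae.
apply: ae_onS (ae_onI (ae_on_oo a b) ae) => t _ [tab [_ [G't _ _ _ _] _]] Gt.
apply: (derivable_at_max (a := a) (b := b)) => // s sab.
by rewrite Gt le0 // in_itv /=; lra.
Qed.

(** Where [G1 < 0], [L1] vanishes. If moreover [G2 = 0], stationarity of [G2] gives
    [dl = L2 + K H2 L2], so [K G1' = K H2 L2 >= 0]; if [G2 < 0], then [K G1' = dl > 0]. *)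
Lemma gap_hardening_active K H1 H2 a b dl G1 G2 L1 L2 : 0 < K -> 0 <= H1 -> 0 <= H2 ->
  a < b -> G1 a = 0 -> gap_dynamics K H1 H2 a b dl G1 G2 L1 L2 ->
  {in `[a, b], forall t, G1 t = 0}.
Proof.
move=> K0 H10 H20 ab G1a dyn t tab.
apply/eqP; rewrite eq_le (gap_dynamics_le0 ab dyn tab) -G1a /=.
move: tab; rewrite in_itv /= => /andP[at_ tb].
case: (dyn) => ac1 _ ae; apply: (ac_nondecreasing at_ (ac_sub (lexx a) tb ac1)).
apply: ae_on_sub (lexx a) tb _.
have st1 := gap_dynamics_stationary ab dyn.
have st2 := gap_dynamics_stationary ab (gap_dynamicsC dyn).
apply: ae_onS (ae_onI ae (ae_onI st1 st2)) => s _.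
move=> [[dl0 [d1 e1 L10 G10 c1] [d2 e2 L20 G20 c2]] [s1 s2]]; split=> //.
have [G1s|G1s] := eqVneq (G1 s) 0; first by rewrite s1.
have L1s : L1 s = 0 by apply: c1; rewrite lt_neqAle G1s.
rewrite -(pmulr_rge0 _ K0) e1 L1s.
have [G2s|G2s] := eqVneq (G2 s) 0.
  move: e2; rewrite s2 // L1s; have : 0 <= K * H2 * L2 s by rewrite !mulr_ge0 // ltW.
  by lra.
have L2s : L2 s = 0 by apply: c2; rewrite lt_neqAle G2s.
by rewrite L2s; lra.
Qed.

Lemma gap_rates_active K H1 H2 a b dl G1 G2 L1 L2 : a < b ->
  gap_dynamics K H1 H2 a b dl G1 G2 L1 L2 -> {in `[a, b], forall t, G1 t = 0} ->
  ae_on a b (fun t => dl t = L1 t + L2 t + K * H1 * L1 t).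
Proof.
move=> ab dyn G10; have st := gap_dynamics_stationary ab dyn.
case: (dyn) => _ _ ae; apply: ae_onS (ae_onI ae st) => t tab.
move=> [[_ [_ e _ _ _] _] s]; move: e; rewrite s ?G10// mulr0; lra.
Qed.

(* As soon as both constraints are inactive both gaps increase, so that the
   larger one cannot have left 0. *)
Lemma gap_max_active K H1 H2 a b dl G1 G2 L1 L2 : 0 < K ->
  a < b -> G1 a = 0 -> gap_dynamics K H1 H2 a b dl G1 G2 L1 L2 ->
  {in `[a, b], forall t, G1 t = 0 \/ G2 t = 0}.
Proof.
move=> K0 ab G1a dyn t tab.
have le1 := gap_dynamics_le0 ab dyn.
have le2 := gap_dynamics_le0 ab (gap_dynamicsC dyn).
have [M0|M0] := leP 0 (Num.max (G1 t) (G2 t)).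
  move: M0; rewrite le_max => /orP[] ?; [left|right];
    apply/eqP; rewrite eq_le ?le1 ?le2//.
exfalso; case: (dyn) => ac1 ac2 ae; move: tab (tab).
rewrite {1}in_itv /= => /andP[at_ tb] tab.
have Ma : 0 <= Num.max (G1 a) (G2 a) by rewrite le_max G1a lexx.
have acM := ac_sub (lexx a) tb (ac_max ac1 ac2).
have [s /andP[as_ st] [Ms neg]] := ac_last_nonneg at_ acM Ma M0.
have incr : ae_on s t (fun r => (derivable G1 r 1 /\ 0 <= G1^`()%classic r) /\
                               (derivable G2 r 1 /\ 0 <= G2^`()%classic r)).
  apply: ae_onS (ae_onI (ae_on_oo s t) (ae_on_sub as_ tb ae)) => r _.
  move=> [/andP[sr rt] [dl0 [d1 e1 _ _ c1] [d2 e2 _ _ c2]]].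
  have := neg r; rewrite sr (ltW rt) gt_max => /(_ isT)/andP[n1 n2].
  move: e1 e2; rewrite c1 ?c2// => e1 e2.
  by split; split=> //; rewrite -(pmulr_rge0 _ K0); lra.
have := neg t; rewrite st lexx gt_max => /(_ isT)/andP[n1 n2].
have m1 : G1 s <= G1 t.
  apply: ac_nondecreasing (ltW st) (ac_sub as_ tb ac1) _.
  by apply: ae_onS incr => r _ [].
have m2 : G2 s <= G2 t.
  apply: ac_nondecreasing (ltW st) (ac_sub as_ tb ac2) _.
  by apply: ae_onS incr => r _ [].
by move: Ms; rewrite le_max => /orP[]; lra.
Qed.

(** Where [G1 < 0] the other gap must be 0, and its stationarity gives [K G1' = K H2 L2], now with
    [H2 < 0]. *)
Lemma gap_softening_nonincreasing K H1 H2 a b dl G1 G2 L1 L2 : 0 < K ->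
  H1 < 0 -> H2 < 0 -> a < b -> G1 a = 0 -> gap_dynamics K H1 H2 a b dl G1 G2 L1 L2 ->
  ae_on a b (fun t => derivable G1 t 1 /\ G1^`()%classic t <= 0).
Proof.
move=> K0 H10 H20 ab G1a dyn.
have st1 := gap_dynamics_stationary ab dyn.
have st2 := gap_dynamics_stationary ab (gap_dynamicsC dyn).
have act := gap_max_active K0 ab G1a dyn; case: dyn => _ _ ae.
apply: ae_onS (ae_onI ae (ae_onI st1 st2)) => t tab.
move=> [[dl0 [d1 e1 L10 G10 c1] [d2 e2 L20 G20 c2]] [s1 s2]]; split=> //.
have [G1t|G1t] := eqVneq (G1 t) 0; first by rewrite s1.
have [/eqP|G2t] := act t tab; first by rewrite (negPf G1t).
have L1t : L1 t = 0 by apply: c1; rewrite lt_neqAle G1t.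
rewrite -(pmulr_rle0 _ K0) e1 L1t; move: e2; rewrite s2// L1t.
have : 0 <= K * - H2 * L2 t by rewrite !mulr_ge0 //; lra.
by lra.
Qed.

(** The cases are decided by the values at the end [b]: a nonincreasing gap that starts at 0 and
    vanishes at [b] vanishes throughout. *)
Lemma gap_softening_trichotomy K H1 H2 a b dl G1 G2 L1 L2 : 0 < K ->
  H1 < 0 -> H2 < 0 -> a < b -> G1 a = 0 -> G2 a = 0 ->
  gap_dynamics K H1 H2 a b dl G1 G2 L1 L2 ->
  [\/ {in `[a, b], forall t, G1 t = 0} /\ {in `]a, b], forall t, G2 t < 0},
      {in `[a, b], forall t, G2 t = 0} /\ {in `]a, b], forall t, G1 t < 0} |
      exists2 c, a < c <= b & {in `[a, c], forall t, G1 t = 0 /\ G2 t = 0}].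
Proof.
move=> K0 H10 H20 ab.
(* The case of a negative second gap at [b], to be used for either order of the springs. The first
   gap is then 0 throughout, and the last zero [c] of the second one decides: localization if
   [c = a], both gaps 0 up to [c] otherwise. *)
have half G1' G2' L1' L2' H1' H2' : H1' < 0 -> H2' < 0 -> G1' a = 0 -> G2' a = 0 ->
    gap_dynamics K H1' H2' a b dl G1' G2' L1' L2' -> G2' b < 0 ->
    {in `[a, b], forall t, G1' t = 0} /\
    ({in `]a, b], forall t, G2' t < 0} \/
     exists2 c, a < c <= b & {in `[a, c], forall t, G1' t = 0 /\ G2' t = 0}).
  move=> H1'0 H2'0 G1a G2a dyn G2b.
  have dynC := gap_dynamicsC dyn.
  have le2 := gap_dynamics_le0 ab dynC.
  have dec1 := gap_softening_nonincreasing K0 H1'0 H2'0 ab G1a dyn.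
  have dec2 := gap_softening_nonincreasing K0 H2'0 H1'0 ab G2a dynC.
  case: (dyn) => ac1 ac2 _.
  have bab : b \in `[a, b] by rewrite in_itv /= lexx ltW.
  have G1b : G1' b = 0.
    by case: (gap_max_active K0 ab G1a dyn bab) => // G2b'; move: G2b; rewrite G2b' ltxx.
  have zero1 : {in `[a, b], forall t, G1' t = 0}.
    move=> t tab; apply/eqP; rewrite eq_le (gap_dynamics_le0 ab dyn tab) /= -G1b.
    move: tab; rewrite in_itv /= => /andP[at_ tb].
    exact: ac_nonincreasing tb (ac_sub at_ (lexx b) ac1) (ae_on_sub at_ (lexx b) dec1).
  split=> //.
  have [|c /andP[ac cb] [G2c neg]] := ac_last_nonneg (ltW ab) ac2 _ G2b.
    by rewrite G2a.
  have [aEc|anc] := eqVneq a c.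
    by left=> t; rewrite in_itv /= aEc; exact: neg.
  right; exists c; first by rewrite lt_neqAle anc ac ltW.
  move=> t; rewrite in_itv /= => /andP[at_ tc].
  have tb : t <= b by lra.
  have tab : t \in `[a, b] by rewrite in_itv /= at_.
  split; first exact: zero1.
  apply/eqP; rewrite eq_le le2 //=; apply: le_trans G2c _.
  by apply: ac_nonincreasing tc (ac_sub at_ (ltW cb) ac2) (ae_on_sub at_ (ltW cb) dec2).
move=> G1a G2a dyn; have dynC := gap_dynamicsC dyn.
have bab : b \in `[a, b] by rewrite in_itv /= lexx ltW.
have := gap_dynamics_le0 ab dyn bab; rewrite le_eqVlt => /orP[/eqP G1b|G1b]; last first.
  have [z [n|[c cab zc]]] := half _ _ _ _ _ _ H20 H10 G2a G1a dynC G1b.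
    by apply: Or32.
  by apply: Or33; exists c => // t /zc[].
have := gap_dynamics_le0 ab dynC bab; rewrite le_eqVlt => /orP[/eqP G2b|G2b]; last first.
  have [z [n|[c cab zc]]] := half _ _ _ _ _ _ H10 H20 G1a G2a dyn G2b.
    by apply: Or31.
  by apply: Or33; exists c.
apply: Or33; exists b; first by rewrite ab lexx.
move=> t tab; move: (tab); rewrite in_itv /= => /andP[at_ tb].
have dec1 := gap_softening_nonincreasing K0 H10 H20 ab G1a dyn.
have dec2 := gap_softening_nonincreasing K0 H20 H10 ab G2a dynC.
case: (dyn) => ac1 ac2 _; split; apply/eqP; rewrite eq_le.
  rewrite (gap_dynamics_le0 ab dyn tab) /= -G1b.
  exact: ac_nonincreasing tb (ac_sub at_ (lexx b) ac1) (ae_on_sub at_ (lexx b) dec1).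
rewrite (gap_dynamics_le0 ab dynC tab) /= -G2b.
exact: ac_nonincreasing tb (ac_sub at_ (lexx b) ac2) (ae_on_sub at_ (lexx b) dec2).
Qed.

End GapDynamics.

(** * Coordinates in the state space *)

Section Coordinates.
Variable R : realType.
Implicit Types (x v : 'cV[R]_3).

Lemma ord3P (P : 'I_3 -> Prop) : P 0 -> P 1 -> P 2%:R -> forall i, P i.
Proof.
move=> P0 P1 P2 [[|[|[|//]]] lti].
- by rewrite (_ : Ordinal lti = 0) //; exact: val_inj.
- by rewrite (_ : Ordinal lti = 1) //; exact: val_inj.
- by rewrite (_ : Ordinal lti = 2%:R) //; exact: val_inj.
Qed.

Lemma st_y_vec3 (y z w : R) : st_y (vec3 y z w) = y.
Proof. by rewrite /st_y mxE. Qed.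

Lemma st_a1_vec3 (y z w : R) : st_a1 (vec3 y z w) = z.
Proof. by rewrite /st_a1 mxE. Qed.

Lemma st_a2_vec3 (y z w : R) : st_a2 (vec3 y z w) = w.
Proof. by rewrite /st_a2 mxE. Qed.

Lemma st_yD x v : st_y (x + v) = st_y x + st_y v.
Proof. by rewrite /st_y mxE. Qed.

Lemma st_a1D x v : st_a1 (x + v) = st_a1 x + st_a1 v.
Proof. by rewrite /st_a1 mxE. Qed.

Lemma st_a2D x v : st_a2 (x + v) = st_a2 x + st_a2 v.
Proof. by rewrite /st_a2 mxE. Qed.

Lemma st_yZ (k : R) v : st_y (k *: v) = k * st_y v.
Proof. by rewrite /st_y mxE. Qed.

Lemma st_a1Z (k : R) v : st_a1 (k *: v) = k * st_a1 v.
Proof. by rewrite /st_a1 mxE. Qed.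

Lemma st_a2Z (k : R) v : st_a2 (k *: v) = k * st_a2 v.
Proof. by rewrite /st_a2 mxE. Qed.

Lemma st_yN v : st_y (- v) = - st_y v.
Proof. by rewrite /st_y mxE. Qed.

Lemma st_a1N v : st_a1 (- v) = - st_a1 v.
Proof. by rewrite /st_a1 mxE. Qed.

Lemma st_a2N v : st_a2 (- v) = - st_a2 v.
Proof. by rewrite /st_a2 mxE. Qed.

Definition stE := (st_yD, st_a1D, st_a2D, st_yN, st_a1N, st_a2N,
  st_yZ, st_a1Z, st_a2Z, st_y_vec3, st_a1_vec3, st_a2_vec3).

Lemma cV3P x v : st_y x = st_y v -> st_a1 x = st_a1 v -> st_a2 x = st_a2 v -> x = v.
Proof.
by move=> e0 e1 e2; apply/matrixP => i j; rewrite (ord1 j); move: i; apply: ord3P.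
Qed.

Lemma cV3_dotE v x : (v^T *m x) 0 0 =
  st_y v * st_y x + st_a1 v * st_a1 x + st_a2 v * st_a2 x.
Proof.
rewrite mxE !big_ord_recl big_ord0 addr0 !mxE addrA /st_y /st_a1 /st_a2.
by congr (_ * _ + v _ _ * x _ _ + v _ _ * x _ _); apply: val_inj.
Qed.

End Coordinates.

(** * The normal cone of the moving set in terms of multipliers *)

Section NormalCone.
Variables (R : realType) (S : two_springs R).
Hypothesis k_gt0 : 0 < k1 S /\ 0 < k2 S.
Hypothesis s_gt0 : 0 < s1 S /\ 0 < s2 S.
Implicit Types (t e : R) (x v d : 'cV[R]_3).

Let compliance_gt0 : 0 < (k1 S)^-1 + (k2 S)^-1.
Proof. by case: k_gt0 => ? ?; rewrite addr_gt0 ?invr_gt0. Qed.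

Lemma kappa_sqr : kappa S ^+ 2 = ((k1 S)^-1 + (k2 S)^-1)^-1.
Proof. by rewrite exprVn sqr_sqrtr // ltW. Qed.

Definition normal_dot1 e d := e * kappa S * st_y d - s1 S * st_a1 d.
Definition normal_dot2 e d := e * kappa S * st_y d - s2 S * st_a2 d.

Lemma moving_setP t a x : f2 S t = 0 ->
  moving_set S t a x <->
  forall e, e = 1 \/ e = -1 ->
    e * (kappa S * st_y x + kappa S ^+ 2 * l S t) - s1 S * (st_a1 x - h1 S * a.1)
      <= c01 S /\
    e * (kappa S * st_y x + kappa S ^+ 2 * l S t) - s2 S * (st_a2 x - h2 S * a.2)
      <= c02 S.
Proof.
move=> f20; rewrite /moving_set /= f20 mul0r scale0r addr0.
set w := vec3 _ _ _; set c := vec4 _ _ _ _.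
have rowE (i : 'I_4) : ((normals S *m w) i 0 <= c i 0) =
    (let n := [:: normal1 S (-1); normal2 S (-1); normal1 S 1; normal2 S 1]`_i in
     st_y n * st_y w + st_a1 n * st_a1 w + st_a2 n * st_a2 w <=
     [:: c01 S; c02 S; c01 S; c02 S]`_i).
  rewrite /= -cV3_dotE [c i 0]mxE; congr (_ <= _).
  by rewrite !mxE; apply: eq_bigr => j _; rewrite !mxE.
split=> [H e e1|H [[|[|[|[|//]]]] lti]].
- have := H (inord 0); have := H (inord 1); have := H (inord 2); have := H (inord 3).
  rewrite !rowE !inordK //= /w /normal1 /normal2 !stE => H3 H2 H1 H0.
  by case: e1 => ->; split; lra.
all: rewrite rowE /= /w /normal1 /normal2 !stE.
- by have [] := H (-1) (or_intror erefl); lra.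
- by have [] := H (-1) (or_intror erefl); lra.
- by have [] := H 1 (or_introl erefl); lra.
- by have [] := H 1 (or_introl erefl); lra.
Qed.

(** The damage inside the set is frozen at [x], so a displacement [d] enters with the full
    coefficient [s_i], while the gap at [x] itself carries [s_i (1 - h_i)]. *)
Lemma curr_set_gap t x d : f2 S t = 0 ->
  curr_set S t x (x + d) <->
  forall e, e = 1 \/ e = -1 ->
    g1 S e t x + normal_dot1 e d <= 0 /\ g2 S e t x + normal_dot2 e d <= 0.
Proof.
move=> f20; rewrite /curr_set moving_setP //.
by split=> H e /H; rewrite /g1 /g2 /normal_dot1 /normal_dot2 !stE /=; lra.
Qed.

Lemma curr_set_self t x : f2 S t = 0 ->
  curr_set S t x x <-> forall e, e = 1 \/ e = -1 -> g1 S e t x <= 0 /\ g2 S e t x <= 0.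
Proof.
move=> f20; rewrite -{2}(addr0 x) curr_set_gap //.
have d0 : (0 : 'cV[R]_3) = vec3 0 0 0 by apply: cV3P; rewrite /st_y /st_a1 /st_a2 !mxE.
by rewrite d0; split=> H e /H; rewrite /normal_dot1 /normal_dot2 !stE !mulr0; lra.
Qed.

(** Karush-Kuhn-Tucker form of a normal vector: nonnegative multipliers with complementary
    slackness. The normals with sign -1 are absent because their constraints are assumed inactive
    wherever this is used. *)
Definition active_combination t x v l1 l2 : Prop :=
  [/\ v = l1 *: normal1 S 1 + l2 *: normal2 S 1, 0 <= l1, 0 <= l2,
      g1 S 1 t x < 0 -> l1 = 0 & g2 S 1 t x < 0 -> l2 = 0].

(* Small multiples of a direction that does not leave the active constraints
   are admissible, so that v cannot point along it. *)
Lemma normal_cone_direction t x v d : f2 S t = 0 -> curr_set S t x x ->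
  g1 S (-1) t x < 0 -> g2 S (-1) t x < 0 ->
  normal_cone (curr_set S t x) x v ->
  (g1 S 1 t x = 0 -> normal_dot1 1 d <= 0) ->
  (g2 S 1 t x = 0 -> normal_dot2 1 d <= 0) ->
  st_y v * st_y d + st_a1 v * st_a1 d + st_a2 v * st_a2 d <= 0.
Proof.
move=> f20 xx m1 m2 cone D1 D2.
have small (g w : R) : g <= 0 -> (g = 0 -> w <= 0) ->
    exists2 r : R, 0 < r & forall r', 0 < r' <= r -> g + r' * w <= 0.
  rewrite le_eqVlt => /orP[/eqP -> /(_ erefl) w0|g0 _].
    by exists 1 => // r' /andP[r'0 _]; rewrite add0r mulr_ge0_le0 // ltW.
  (* For [r'] up to this bound, [r' * w] does not exceed the slack [- g]. *)
  exists (- g / (`|w| + 1)); first by rewrite divr_gt0; have := normr_ge0 w; lra.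
  move=> r' /andP[r'0]; rewrite ler_pdivlMr; last by have := normr_ge0 w; lra.
  have := ler_norm w => le H; have : r' * w <= r' * `|w| by rewrite ler_pM2l.
  by lra.
have P e : e = 1 \/ e = -1 -> g1 S e t x <= 0 /\ g2 S e t x <= 0.
  exact: (curr_set_self x f20).1.
have [p1 p2] := P 1 (or_introl erefl).
have nz (g : R) (Q : Prop) : g < 0 -> g = 0 -> Q by move=> g0 E; move: g0; rewrite E ltxx.
have [ra ra0 Ha] := small _ _ p1 D1; have [rb rb0 Hb] := small _ _ p2 D2.
have [rc rc0 Hc] := small _ (normal_dot1 (-1) d) (ltW m1) (fun E => nz _ _ m1 E).
have [rd rd0 Hd] := small _ (normal_dot2 (-1) d) (ltW m2) (fun E => nz _ _ m2 E).
pose r := Num.min (Num.min ra rb) (Num.min rc rd).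
have r0 : 0 < r by rewrite !lt_min ra0 rb0 rc0.
have [ra' rb' rc' rd'] : [/\ r <= ra, r <= rb, r <= rc & r <= rd].
  by rewrite /r !ge_min !lexx ?orbT.
have := cone (x + r *: d); rewrite addrAC subrr add0r cV3_dotE !stE.
have -> : st_y v * (r * st_y d) + st_a1 v * (r * st_a1 d) + st_a2 v * (r * st_a2 d)
  = r * (st_y v * st_y d + st_a1 v * st_a1 d + st_a2 v * st_a2 d) by ring.
rewrite pmulr_rle0 //; apply; apply/curr_set_gap => // e.
have dotZ1 : normal_dot1 e (r *: d) = r * normal_dot1 e d.
  by rewrite /normal_dot1 !stE; ring.
have dotZ2 : normal_dot2 e (r *: d) = r * normal_dot2 e d.
  by rewrite /normal_dot2 !stE; ring.
by rewrite dotZ1 dotZ2; case=> ->; split; [apply: Ha|apply: Hb|apply: Hc|apply: Hd];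
  rewrite r0.
Qed.

(** Each normal has a damage coordinate of its own, equal to [- s_i], so the multipliers can be read
    off from [v] and checked against a few test directions. *)
Lemma normal_coneP t x v : f2 S t = 0 -> curr_set S t x x ->
  g1 S (-1) t x < 0 -> g2 S (-1) t x < 0 ->
  normal_cone (curr_set S t x) x v <-> exists l1 l2, active_combination t x v l1 l2.
Proof.
move=> f20 xx m1 m2; have [s10 s20] := s_gt0.
have [p1 p2] := (curr_set_self x f20).1 xx 1 (or_introl erefl).
split=> [cone|[l1 [l2 [-> l10 l20 c1 c2]]] c xc].
- have dir d := normal_cone_direction f20 xx m1 m2 cone (d := d).
  have s1n : s1 S != 0 by rewrite gt_eqF.
  have s2n : s2 S != 0 by rewrite gt_eqF.
  have K1 : s1 S * (kappa S / s1 S) = kappa S by rewrite mulrC divfK.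
  have K2 : s2 S * (kappa S / s2 S) = kappa S by rewrite mulrC divfK.
  (* [A] and [B] are opposite directions tangent to both constraint planes and fix [st_y v]. [C] and
     [D] relax one constraint each and give the signs of the multipliers; [E] and [F] violate one
     constraint each and are admissible only if it is inactive, which makes its multiplier 0. *)
  have A := dir (vec3 1 (kappa S / s1 S) (kappa S / s2 S)).
  have B := dir (vec3 (-1) (- (kappa S / s1 S)) (- (kappa S / s2 S))).
  have C := dir (vec3 0 1 0); have D := dir (vec3 0 0 1).
  have E := dir (vec3 0 (-1) 0); have F := dir (vec3 0 0 (-1)).
  rewrite /normal_dot1 /normal_dot2 !stE in A B C D E F.
  exists (- st_a1 v / s1 S), (- st_a2 v / s2 S); split.
  + apply: cV3P; rewrite /normal1 /normal2 !stE; last 2 first.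
    * by field; rewrite s1n s2n.
    * by field; rewrite s1n s2n.
    have eq1 : st_y v = - (kappa S / s1 S * st_a1 v + kappa S / s2 S * st_a2 v).
      apply/eqP; rewrite eq_le; apply/andP; split.
        by have := A _ _; rewrite K1 K2; lra.
      by have := B _ _; rewrite !mulrN K1 K2; lra.
    by rewrite eq1; field; rewrite s1n s2n.
  + by rewrite divr_ge0 ?(ltW s10) ?(ltW s20)//; have := C _ _; lra.
  + by rewrite divr_ge0 ?(ltW s10) ?(ltW s20)//; have := D _ _; lra.
  + move=> g1n; apply/eqP; rewrite mulf_eq0 oppr_eq0; apply/orP; left.
    by rewrite eq_le; apply/andP; split; [have := C _ _|have := E _ _]; lra.
  + move=> g2n; apply/eqP; rewrite mulf_eq0 oppr_eq0; apply/orP; left.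
    by rewrite eq_le; apply/andP; split; [have := D _ _|have := F _ _]; lra.
(* Conversely, an admissible displacement does not increase an active constraint, and inactive ones
   have multiplier 0; so each product below is nonpositive. *)
- have [d xdc] : exists d, c = x + d by exists (c - x); rewrite addrC subrK.
  move: xc; rewrite xdc => /(curr_set_gap _ _ f20)/(_ 1 (or_introl erefl)) [d1 d2].
  rewrite addrAC subrr add0r cV3_dotE /normal1 /normal2 !stE.
  have T1 : l1 * normal_dot1 1 d <= 0.
    have [g0|gn] := eqVneq (g1 S 1 t x) 0.
      by move: d1; rewrite g0 add0r; exact: mulr_ge0_le0.
    by rewrite c1 ?mul0r // lt_neqAle gn.
  have T2 : l2 * normal_dot2 1 d <= 0.
    have [g0|gn] := eqVneq (g2 S 1 t x) 0.
      by move: d2; rewrite g0 add0r; exact: mulr_ge0_le0.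
    by rewrite c2 ?mul0r // lt_neqAle gn.
  by move: T1 T2; rewrite /normal_dot1 /normal_dot2; lra.
Qed.

End NormalCone.

(** * Solutions of the sweeping process and their rates *)

Section Rates.
Variables (R : realType) (S : two_springs R) (t0 T : R) (u0 : 'cV[R]_3).
Hypothesis t0_lt_T : t0 < T.
Hypothesis k_gt0 : 0 < k1 S /\ 0 < k2 S.
Hypothesis s_gt0 : 0 < s1 S /\ 0 < s2 S.
Hypothesis l_lipschitz : [lipschitz (l S) t | t in `[t0, T]].
Hypothesis l_t0 : l S t0 = 0.
Hypothesis l_increasing :
  ae_on t0 T (fun t => derivable (l S) t 1 /\ 0 < (l S)^`()%classic t).
Hypothesis f2_zero : ae_on t0 T (fun t => f2 S t = 0).
Hypothesis plus_active : g1 S 1 t0 u0 = 0 /\ g2 S 1 t0 u0 = 0.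
Hypothesis minus_inactive0 : g1 S (-1) t0 u0 < 0 /\ g2 S (-1) t0 u0 < 0.
Implicit Types (t s tau e m : R) (u x : R -> 'cV[R]_3) (v w : 'cV[R]_3).

Let K := (k1 S)^-1 + (k2 S)^-1.
Let H1 := (1 - h1 S) * s1 S ^+ 2.
Let H2 := (1 - h2 S) * s2 S ^+ 2.
Let dl := (l S)^`()%classic.

Let K_gt0 : 0 < K.
Proof. by case: k_gt0 => ? ?; rewrite addr_gt0 ?invr_gt0. Qed.

Let kappa2 : K * kappa S ^+ 2 = 1.
Proof. by rewrite kappa_sqr // mulfV // gt_eqF. Qed.

(** The velocity belonging to multipliers [m1] and [m2]; all rates in the theorem have this form. *)
Definition combination m1 m2 : 'cV[R]_3 := - (m1 *: normal1 S 1 + m2 *: normal2 S 1).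

Lemma st_combination m1 m2 :
  [/\ st_y (combination m1 m2) = - (kappa S * (m1 + m2)),
      st_a1 (combination m1 m2) = s1 S * m1 & st_a2 (combination m1 m2) = s2 S * m2].
Proof. by rewrite /combination /normal1 /normal2 !stE; split; ring. Qed.

Lemma combinationZ k m1 m2 : k *: combination m1 m2 = combination (k * m1) (k * m2).
Proof. by rewrite /combination scalerN scalerDr !scalerA. Qed.

Lemma combination_inj m1 m2 m1' m2' :
  combination m1 m2 = combination m1' m2' -> m1 = m1' /\ m2 = m2'.
Proof.
have [? ?] := s_gt0.
have [_ a1 a2] := st_combination m1 m2; have [_ b1 b2] := st_combination m1' m2'.
move=> E; move: a1 a2; rewrite E b1 b2 => /mulfI-> => [/mulfI-> //|]; by rewrite gt_eqF.
Qed.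

Lemma entry_derive1 u t i : derivable u t 1 ->
  derivable (fun s => u s i 0) t 1 /\
  (fun s => u s i 0)^`()%classic t = u^`()%classic t i 0.
Proof.
move=> ut; split; first by move/derivable_mxP : ut.
by rewrite !derive1E derive_mx // mxE.
Qed.

Lemma gap_derive1 (f g h : R -> R) e (p q r c : R) t :
  derivable f t 1 -> derivable g t 1 -> derivable h t 1 ->
  let G := fun s => e * (p * f s + q * g s) - r * h s - c in
  derivable G t 1 /\ G^`()%classic t =
    e * (p * f^`()%classic t + q * g^`()%classic t) - r * h^`()%classic t.
Proof.
move=> ft gt_ ht G.
have EG : G = e *: (p *: f + q *: g) - r *: h - cst c by apply/funext.
have Df := is_deriveZ p (derivableP ft); have Dg := is_deriveZ q (derivableP gt_).
have Dh := is_deriveZ r (derivableP ht).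
have [d E] := is_deriveB (is_deriveB (is_deriveZ e (is_deriveD Df Dg)) Dh)
  (is_derive_cst c t 1).
rewrite -EG in d E.
by split=> //; rewrite !derive1E E subr0.
Qed.

(** The factor [K] cancels [kappa ^+ 2], so that no square root remains. *)
Lemma gap_rate u t m1 m2 : derivable u t 1 -> derivable (l S) t 1 ->
  u^`()%classic t = combination m1 m2 ->
  let G1 := fun s => g1 S 1 s (u s) in let G2 := fun s => g2 S 1 s (u s) in
  (derivable G1 t 1 /\ K * G1^`()%classic t = dl t - (m1 + m2) - K * H1 * m1) /\
  (derivable G2 t 1 /\ K * G2^`()%classic t = dl t - (m1 + m2) - K * H2 * m2).
Proof.
move=> ut lt_ u' G1 G2.
have [y ey] := entry_derive1 0 ut; have [a ea] := entry_derive1 1 ut.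
have [b eb] := entry_derive1 2%:R ut; have [cy ca cb] := st_combination m1 m2.
have [d1 e1] := gap_derive1 1 (kappa S) (kappa S ^+ 2) (s1 S * (1 - h1 S)) (c01 S) y lt_ a.
have [d2 e2] := gap_derive1 1 (kappa S) (kappa S ^+ 2) (s2 S * (1 - h2 S)) (c02 S) y lt_ b.
have step z m (h k : R) : K * (1 * (kappa S * - (kappa S * (m1 + m2)) + kappa S ^+ 2 * dl t)
    - k * (1 - h) * (k * m)) = dl t - (m1 + m2) - K * ((1 - h) * k ^+ 2) * m.
  have -> : K * (1 * (kappa S * - (kappa S * (m1 + m2)) + kappa S ^+ 2 * dl t)
    - k * (1 - h) * (k * m)) = (K * kappa S ^+ 2) * (dl t - (m1 + m2))
      - K * ((1 - h) * k ^+ 2) * m by ring.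
  by rewrite kappa2 mul1r.
split; split=> //.
  rewrite [X in K * X](e1) ey ea u' -/(st_y (combination m1 m2)) -/(st_a1 (combination m1 m2)).
  by rewrite cy ca; exact: step.
rewrite [X in K * X](e2) ey eb u' -/(st_y (combination m1 m2)) -/(st_a2 (combination m1 m2)).
by rewrite cy cb; exact: step.
Qed.

Lemma l_ac tau : tau <= T -> absolutely_continuous t0 tau (l S).
Proof. by move=> tauT; apply: ac_sub (lexx t0) tauT (ac_lipschitz l_lipschitz). Qed.

Lemma gap_ac tau u e : tau <= T -> absolutely_continuous t0 tau u ->
  absolutely_continuous t0 tau (fun s => g1 S e s (u s)) /\
  absolutely_continuous t0 tau (fun s => g2 S e s (u s)).
Proof.
move=> tauT acu; have gap i r c : absolutely_continuous t0 tau
    (fun s => e * (kappa S * st_y (u s) + kappa S ^+ 2 * l S s) - r * u s i 0 - c).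
  have -> : (fun s => e * (kappa S * st_y (u s) + kappa S ^+ 2 * l S s) - r * u s i 0 - c) =
     (fun s => e *: (kappa S *: u s 0 0 + kappa S ^+ 2 *: l S s) + (- r) *: u s i 0 + (- c)).
    by apply/funext => s; rewrite /GRing.scale /= mulNr.
  apply: acD; last exact: ac_cst.
  apply: acD; last exact/acZ/ac_entry.
  by apply/acZ/acD; apply: acZ; [exact: ac_entry|exact: l_ac].
by split; apply: gap.
Qed.

Lemma l_mono s t : t0 <= s -> s <= t -> t <= T -> l S s <= l S t.
Proof.
move=> ts st tT; apply: ac_nondecreasing st (ac_sub ts (lexx t) (l_ac tT)) _.
by apply: ae_onS (ae_on_sub ts tT l_increasing) => r _ [dr r0]; split; rewrite ?ltW.
Qed.

Lemma l_ge0 t : t0 <= t <= T -> 0 <= l S t.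
Proof. by move=> /andP[tt tT]; rewrite -l_t0; apply: l_mono. Qed.

(** If [l] vanished at [t], monotonicity would make it 0 on the whole interval from [t0] to [t],
    contradicting a positive derivative at some interior point. *)
Lemma l_gt0 t : t0 < t <= T -> 0 < l S t.
Proof.
move=> /andP[tt tT]; rewrite lt_neqAle l_ge0 ?tT ?ltW // andbT; apply/eqP => lt0.
have [s [/andP[ts st] [ds]]] := ae_on_ex tt (ae_on_sub (lexx t0) tT l_increasing).
rewrite (derivable_at_max (a := t0) (b := t)) ?ltxx ?ts // => r /andP[tr rt].
have : l S r <= l S t by apply: l_mono; lra.
have : 0 <= l S s by apply: l_ge0; lra.
by rewrite -lt0; lra.
Qed.

(** Each entry of [u - l v] is absolutely continuous with derivative 0 almost everywhere, hence
    constant. *)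
Lemma has_rate_line v tau u : t0 < tau <= T -> ac_from t0 u0 tau u ->
  has_rate S t0 v tau u -> {in `[t0, tau], forall t, u t = u0 + l S t *: v}.
Proof.
move=> /andP[t0tau tauT] [acu ut0] rate t ttau.
apply/matrixP => i j; rewrite (ord1 j) {j} !mxE; apply/eqP; rewrite -subr_eq; apply/eqP.
pose F s := u s i 0 + (- v i 0) *: l S s.
have acF : absolutely_continuous t0 tau F.
  by apply: acD; [exact: ac_entry|exact/acZ/l_ac].
suff : F t = F t0 by rewrite /F l_t0 scaler0 addr0 ut0 /GRing.scale /= => <-; ring.
apply: (ac_constant acF _ ttau).
apply: ae_onS (ae_onI rate (ae_on_sub (lexx t0) tauT l_increasing)) => s _.
move=> [[us [_ -> u's]] [ls _]]; have [d e] := entry_derive1 i us.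
have EF : F = (fun s => u s i 0) + (- v i 0) *: l S by apply/funext.
have [dF eF] : is_derive s (1 : R) F ('D_1 (fun s => u s i 0) s + (- v i 0) *: 'D_1 (l S) s).
  by rewrite EF; apply: is_deriveD; [|apply: is_deriveZ]; exact: derivableP.
split=> //; rewrite derive1E eF -!derive1E e u's mxE /GRing.scale /=; ring.
Qed.

(** The two solutions are [u0 + l(t) v] and [u0 + l(t) w], with [l(t) > 0] after [t0]. *)
Lemma branch_neq v w : v <> w -> branch_at_start S t0 T u0 v w.
Proof.
move=> vw tau u x tauT [[acu _] _] ru [[acx _] _] rx t /andP[tt ttau].
have tin : t \in `[t0, tau] by rewrite in_itv /= ltW.
rewrite (has_rate_line tauT acu ru tin) (has_rate_line tauT acx rx tin).
move/addrI => /scalerI E; apply: vw; apply: E.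
by rewrite gt_eqF // l_gt0 // tt /=; case/andP: tauT => _; exact: le_trans.
Qed.

(** Since the damage rate of spring i is [s_i] times its multiplier, the multipliers are explicit
    functions of time and need not be chosen pointwise. *)
Definition multiplier1 u t := st_a1 (u^`()%classic t) / s1 S.
Definition multiplier2 u t := st_a2 (u^`()%classic t) / s2 S.

Lemma multiplier_combination u t m1 m2 : u^`()%classic t = combination m1 m2 ->
  multiplier1 u t = m1 /\ multiplier2 u t = m2.
Proof.
have [? ?] := s_gt0; have [_ a1 a2] := st_combination m1 m2.
by move=> E; rewrite /multiplier1 /multiplier2 E a1 a2; split;
  rewrite mulrC mulKf // gt_eqF.
Qed.

(** Passage from the differential inclusion to the gap dynamics, through the description of the
    normal cone by multipliers. *)
Lemma solution_multipliers tau u : t0 < tau <= T -> valid_solution S t0 u0 tau u ->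
  [/\ gap_dynamics K H1 H2 t0 tau dl (fun t => g1 S 1 t (u t)) (fun t => g2 S 1 t (u t))
        (multiplier1 u) (multiplier2 u),
      ae_on t0 tau (fun t => derivable u t 1 /\
        u^`()%classic t = combination (multiplier1 u t) (multiplier2 u t)),
      g1 S 1 t0 (u t0) = 0 & g2 S 1 t0 (u t0) = 0].
Proof.
move=> /andP[t0tau tauT] [[[acu ut0] sol] minus].
have comb : ae_on t0 tau (fun t => [/\ derivable u t 1, derivable (l S) t 1 /\ 0 < dl t,
    g1 S 1 t (u t) <= 0 /\ g2 S 1 t (u t) <= 0 &
    u^`()%classic t = combination (multiplier1 u t) (multiplier2 u t) /\
    active_combination S t (u t) (- u^`()%classic t) (multiplier1 u t) (multiplier2 u t)]).
  apply: ae_onS (ae_onI sol (ae_onI (ae_on_sub (lexx t0) tauT l_increasing)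
    (ae_on_sub (lexx t0) tauT f2_zero))) => t ttau [[ut cs cone] [lt_ f20]].
  have [m1 m2] := minus t ttau; split=> //.
    exact: ((curr_set_self _ f20).1 cs 1 (or_introl erefl)).
  have [l1 [l2 act]] := (normal_coneP s_gt0 _ f20 cs m1 m2).1 cone.
  have E : u^`()%classic t = combination l1 l2.
    by rewrite /combination; case: act => <- *; rewrite opprK.
  by have [-> ->] := multiplier_combination E.
have [ac1 ac2] := gap_ac 1 tauT acu.
split; rewrite ?ut0; try by case: plus_active.
  split=> //; apply: ae_onS comb => t _ [ut [lt_ dl0] [p1 p2] [u' [_ l10 l20 c1 c2]]].
  have [[d1 e1] [d2 e2]] := gap_rate ut lt_ u'.
  by split=> //; split.
by apply: ae_onS comb => t _ [ut _ _ [u' _]].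
Qed.

(** The way back, by which solutions are constructed. *)
Lemma solution_of_multipliers tau u (L1 L2 : R -> R) : tau <= T -> ac_from t0 u0 tau u ->
  minus_inactive S t0 tau u ->
  ae_on t0 tau (fun t => [/\ derivable u t 1, u^`()%classic t = combination (L1 t) (L2 t),
    0 <= L1 t /\ 0 <= L2 t, g1 S 1 t (u t) <= 0 /\ g2 S 1 t (u t) <= 0 &
    (g1 S 1 t (u t) < 0 -> L1 t = 0) /\ (g2 S 1 t (u t) < 0 -> L2 t = 0)]) ->
  solution S t0 u0 tau u.
Proof.
move=> tauT acu minus ae; split=> //.
apply: ae_onS (ae_onI ae (ae_on_sub (lexx t0) tauT f2_zero)) => t ttau.
move=> [[ut u' [l10 l20] [p1 p2] [c1 c2]] f20].
have [m1 m2] := minus t ttau.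
have cs : curr_set S t (u t) (u t).
  by apply/curr_set_self => // e [] ->; split=> //; exact: ltW.
split=> //; apply/normal_coneP => //; exists (L1 t), (L2 t); split=> //.
by rewrite u' /combination opprK.
Qed.

Lemma is_derive_scalel (f : R -> R) v t : derivable f t 1 ->
  is_derive t (1 : R) (fun s => f s *: v) ('D_1 f t *: v).
Proof.
move=> ft; have entryE i j : (fun s => (f s *: v) i j) = v i j *: f.
  by apply/funext => s; rewrite mxE mulrC.
have dm : derivable (fun s => f s *: v) t 1.
  by apply/derivable_mxP => i j; rewrite entryE; exact: derivableZ.
split=> //; rewrite derive_mx //; apply/matrixP => i j.
by rewrite !mxE entryE deriveZ //= [RHS]mulrC.
Qed.

(** For [u = u0 + l(t) v] the gaps satisfy [K G_i = l(t) r_i] with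
    [r_i = 1 - (m1 + m2) - K H_i m_i]. Feasibility and complementary slackness thus become the
    algebraic conditions assumed on [r_i]. *)
Lemma present_combination m1 m2 : 0 <= m1 -> 0 <= m2 ->
  1 - (m1 + m2) - K * H1 * m1 <= 0 -> 1 - (m1 + m2) - K * H2 * m2 <= 0 ->
  (1 - (m1 + m2) - K * H1 * m1 < 0 -> m1 = 0) ->
  (1 - (m1 + m2) - K * H2 * m2 < 0 -> m2 = 0) ->
  present S t0 T u0 (combination m1 m2).
Proof.
move=> m10 m20 r1 r2 c1 c2; pose v := combination m1 m2.
pose u t := u0 + l S t *: v.
have acu : ac_from t0 u0 T u.
  split; last by rewrite /u l_t0 scale0r addr0.
  apply: acD; first exact: ac_cst.
  apply: (@ac_dominated _ _ _ `|v| _ _ (l S)); last exact: l_ac.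
  by move=> s t _ _; rewrite -scalerBl normrZ mulrC.
have rate : has_rate S t0 v T u.
  apply: ae_onS l_increasing => t _ [lt_ _].
  have eu : u = cst u0 + (fun s => l S s *: v) by apply/funext.
  have lv := is_derive_scalel v lt_.
  have [du e] : is_derive t (1 : R) u (0 + 'D_1 (l S) t *: v).
    by rewrite eu; apply: is_deriveD.
  by split=> //; exists v => //; rewrite !derive1E e add0r.
exists u; split=> //.
  (* By continuity the gaps with sign -1 stay negative for some time after [t0]. *)
  have neg (f : R -> R) : absolutely_continuous t0 T f -> f t0 < 0 ->
      exists2 d : R, 0 < d & forall t, t \in `[t0, T] -> t < t0 + d -> f t < 0.
    move=> acf ft0; have ft0' : 0 < - f t0 by lra.
    have [d d0 H] := ac_unif acf ft0'; exists d => // t tT td.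
    have t0T : t0 \in `[t0, T] by rewrite in_itv /= lexx ltW.
    have td' : `|t - t0| < d.
      by move: tT; rewrite in_itv /= => /andP[tt _]; rewrite ger0_norm; lra.
    by have := H t0 t t0T tT td'; have := ler_norm (f t - f t0); lra.
  have [acg1 acg2] := gap_ac (-1) (lexx T) acu.1; have ut0 := acu.2.
  have [|d1 d10 N1] := neg _ acg1; first by rewrite ut0; case: minus_inactive0.
  have [|d2 d20 N2] := neg _ acg2; first by rewrite ut0; case: minus_inactive0.
  have [r [r0 rT rd1 rd2]] : exists r, [/\ 0 < r, r <= T - t0, r < d1 & r < d2].
    exists (Num.min (T - t0) (Num.min (d1 / 2) (d2 / 2))); split.
    - by rewrite !lt_min subr_gt0 t0_lt_T !divr_gt0.
    - by rewrite ge_min lexx.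
    - by rewrite !gt_min; apply/orP; right; apply/orP; left; lra.
    - by rewrite !gt_min; apply/orP; right; apply/orP; right; lra.
  exists (t0 + r); first by lra.
  move=> t; rewrite in_itv /= => /andP[tt tr]; split; [apply: N1|apply: N2];
    rewrite ?in_itv /=; lra.
move=> tau /andP[t0tau tauT] minus.
apply: (@solution_of_multipliers _ _ (fun t => dl t * m1) (fun t => dl t * m2)) => //.
  by split; [exact: ac_sub (lexx t0) tauT acu.1|exact: acu.2].
apply: ae_onS (ae_on_sub (lexx t0) tauT (ae_onI rate l_increasing)) => t.
rewrite in_itv /= => /andP[tt ttau] [[ut [_ -> u']] [_ dl0]].
have [cy ca cb] := st_combination m1 m2.
have [q1 q2] := plus_active.
have lt0 : 0 <= l S t by apply: l_ge0; lra.
have gapE (h k m c z : R) :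
  1 * (kappa S * st_y u0 + kappa S ^+ 2 * l S t0) - k * (1 - h) * z - c = 0 ->
  K * (1 * (kappa S * (st_y u0 + l S t * - (kappa S * (m1 + m2))) + kappa S ^+ 2 * l S t)
    - k * (1 - h) * (z + l S t * (k * m)) - c) =
  l S t * (1 - (m1 + m2) - K * ((1 - h) * k ^+ 2) * m).
  rewrite l_t0 => E.
  have -> : K * (1 * (kappa S * (st_y u0 + l S t * - (kappa S * (m1 + m2))) + kappa S ^+ 2 * l S t)
    - k * (1 - h) * (z + l S t * (k * m)) - c) =
    (K * kappa S ^+ 2) * (l S t * (1 - (m1 + m2))) - l S t * (K * ((1 - h) * k ^+ 2) * m)
    + K * (1 * (kappa S * st_y u0 + kappa S ^+ 2 * 0) - k * (1 - h) * z - c) by ring.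
  by rewrite E kappa2; ring.
have G1t : K * g1 S 1 t (u t) = l S t * (1 - (m1 + m2) - K * H1 * m1).
  by rewrite /g1 /u st_yD st_yZ cy st_a1D st_a1Z ca; exact: gapE.
have G2t : K * g2 S 1 t (u t) = l S t * (1 - (m1 + m2) - K * H2 * m2).
  by rewrite /g2 /u st_yD st_yZ cy st_a2D st_a2Z cb; exact: gapE.
have slack (G r m : R) : K * G = l S t * r -> r <= 0 -> (r < 0 -> m = 0) ->
    G <= 0 /\ (G < 0 -> dl t * m = 0).
  move=> E r0 rm; split; first by rewrite -(pmulr_rle0 _ K_gt0) E mulr_ge0_le0.
  move=> G0; rewrite rm ?mulr0 // lt_neqAle r0 andbT; apply/eqP => rz.
  by move: G0; rewrite -(pmulr_rlt0 _ K_gt0) E rz mulr0 ltxx.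
have [p1 z1] := slack _ _ _ G1t r1 c1; have [p2 z2] := slack _ _ _ G2t r2 c2.
by split=> //; rewrite ?u' ?combinationZ // !mulr_ge0 // ltW.
Qed.

(** One generic time suffices: the multipliers there are [l' m1] and [l' m2] with [l' > 0]. If both
    vanished, then [K G1' = l' > 0], but under softening the gap is nonincreasing. *)
Lemma possible_combination m1 m2 : H1 < 0 -> H2 < 0 ->
  possible S t0 T u0 (combination m1 m2) -> [/\ 0 <= m1, 0 <= m2 & 0 < m1 + m2].
Proof.
move=> H10 H20 [tau [u [tauT val rate]]]; have /andP[t0tau tau_le] := tauT.
have [dyn _ G1t0 _] := solution_multipliers tauT val.
have dec := gap_softening_nonincreasing K_gt0 H10 H20 t0tau G1t0 dyn.
case: dyn => _ _ dyn.
have [t [_ [[[dl0 [_ e1 L10 _ _] [_ _ L20 _ _]] [_ dG]] [_ [_ -> u']]]]] :=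
  ae_on_ex t0tau (ae_onI (ae_onI dyn dec) rate).
rewrite combinationZ in u'; have [M1 M2] := multiplier_combination u'.
rewrite -[(l S)^`()%classic]/dl in M1 M2.
rewrite M1 pmulr_rge0 // in L10; rewrite M2 pmulr_rge0 // in L20; split=> //.
rewrite lt_neqAle addr_ge0 // andbT eq_sym; apply/negP => /eqP m12.
have m10 : m1 = 0 by lra.
have m20 : m2 = 0 by lra.
move: e1; rewrite M1 M2 m10 m20 !mulr0 addr0 !subr0 => e1.
by have := mulr_ge0_le0 (ltW K_gt0) dG; rewrite e1; lra.
Qed.

Lemma has_rate_combination tau u m1 m2 :
  ae_on t0 tau (fun t => derivable u t 1 /\
    u^`()%classic t = combination (multiplier1 u t) (multiplier2 u t)) ->
  ae_on t0 tau (fun t => multiplier1 u t = dl t * m1 /\ multiplier2 u t = dl t * m2) ->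
  has_rate S t0 (combination m1 m2) tau u.
Proof.
move=> ae1 ae2; apply: ae_onS (ae_onI ae1 ae2) => t _ [[ut ->] [-> ->]].
by split=> //; exists (combination m1 m2) => //; rewrite combinationZ.
Qed.

(** * The explicit rates, and the distributed one when both constraints stay active *)

Lemma distributed_denE : distributed_den S = H1 + H2 + K * H1 * H2.
Proof. by rewrite /distributed_den /K /H1 /H2; ring. Qed.

Lemma distributed_rateE : distributed_rate S =
  combination (H2 / distributed_den S) (H1 / distributed_den S).
Proof.
by rewrite /distributed_rate /combination scalerDr !scalerA !(mulrC _^-1).
Qed.

Lemma localized_rate1E : localized_rate1 S = combination (1 + K * H1)^-1 0.
Proof. by rewrite /localized_rate1 /combination scale0r addr0 /H1 !mulrA. Qed.

Lemma localized_rate2E : localized_rate2 S = combination 0 (1 + K * H2)^-1.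
Proof. by rewrite /localized_rate2 /combination scale0r add0r /H2 !mulrA. Qed.

Lemma active_multipliers tau u : t0 < tau <= T -> valid_solution S t0 u0 tau u ->
  {in `[t0, tau], forall t, g1 S 1 t (u t) = 0 /\ g2 S 1 t (u t) = 0} ->
  ae_on t0 tau (fun t => [/\ 0 < dl t,
    dl t = multiplier1 u t + multiplier2 u t + K * H1 * multiplier1 u t &
    dl t = multiplier1 u t + multiplier2 u t + K * H2 * multiplier2 u t]).
Proof.
move=> tauT val act; have /andP[t0tau tau_le] := tauT.
have [dyn _ _ _] := solution_multipliers tauT val.
have r1 := gap_rates_active t0tau dyn (fun t tt => (act t tt).1).
have r2 := gap_rates_active t0tau (gap_dynamicsC dyn) (fun t tt => (act t tt).2).
apply: ae_onS (ae_onI r1 (ae_onI r2 (ae_on_sub (lexx t0) tau_le l_increasing))).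
by move=> t _ [e1 [e2 [_ dl0]]]; split=> //; rewrite addrC in e2; rewrite e2; ring.
Qed.

(** The two activity equations give [H1 L1 = H2 L2], hence [L1 D = l' H2] and [L2 D = l' H1] with
    [D] the denominator. That [D] is nonzero follows from [l' H2] being nonzero. *)
Lemma has_rate_distributed tau u : t0 < tau <= T -> valid_solution S t0 u0 tau u ->
  H2 != 0 ->
  {in `[t0, tau], forall t, g1 S 1 t (u t) = 0 /\ g2 S 1 t (u t) = 0} ->
  has_rate S t0 (distributed_rate S) tau u.
Proof.
move=> tauT val H20 act; have [_ rate _ _] := solution_multipliers tauT val.
rewrite distributed_rateE; apply: has_rate_combination rate _.
apply: ae_onS (active_multipliers tauT val act) => t _ [dl0 e1 e2].
have E1 : multiplier1 u t * distributed_den S = dl t * H2.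
  have E : H1 * multiplier1 u t = H2 * multiplier2 u t.
    by apply: (@mulfI _ K); [rewrite gt_eqF|lra].
  by rewrite distributed_denE e1; lra.
have E2 : multiplier2 u t * distributed_den S = dl t * H1.
  have E : H1 * multiplier1 u t = H2 * multiplier2 u t.
    by apply: (@mulfI _ K); [rewrite gt_eqF|lra].
  by rewrite distributed_denE e2; lra.
have D0 : distributed_den S != 0.
  apply/eqP => D0; move/eqP: E1; rewrite D0 mulr0 eq_sym mulf_eq0 (negPf H20) orbF.
  by rewrite gt_eqF.
by split; rewrite mulrA; [rewrite -E1|rewrite -E2]; rewrite mulfK.
Qed.

Lemma present_distributed : distributed_den S != 0 ->
  0 <= H1 / distributed_den S -> 0 <= H2 / distributed_den S ->
  present S t0 T u0 (distributed_rate S).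
Proof.
move=> D0 m20 m10; rewrite distributed_rateE.
have D0' : H1 + H2 + K * H1 * H2 != 0 by rewrite -distributed_denE.
have r1 : 1 - (H2 / distributed_den S + H1 / distributed_den S) -
    K * H1 * (H2 / distributed_den S) = 0 by rewrite distributed_denE; field.
have r2 : 1 - (H2 / distributed_den S + H1 / distributed_den S) -
    K * H2 * (H1 / distributed_den S) = 0 by rewrite distributed_denE; field.
by apply: present_combination => //; rewrite ?r1 ?r2 ?ltxx.
Qed.

(** * Hardening and perfect plasticity *)

Lemma hardening_active tau u : 0 <= H1 -> 0 <= H2 -> t0 < tau <= T ->
  valid_solution S t0 u0 tau u ->
  {in `[t0, tau], forall t, g1 S 1 t (u t) = 0 /\ g2 S 1 t (u t) = 0}.
Proof.
move=> H10 H20 tauT val t tin; have /andP[t0tau _] := tauT.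
have [dyn _ G1t0 G2t0] := solution_multipliers tauT val; split.
  exact: (gap_hardening_active K_gt0 H10 H20 t0tau G1t0 dyn).
exact: (gap_hardening_active K_gt0 H20 H10 t0tau G2t0 (gap_dynamicsC dyn)).
Qed.

(** With [H1 = H2 = 0] activity of both constraints only says [L1 + L2 = l'], and this equation in
    turn keeps both gaps at 0. The parameter [theta] may vary with time. *)
Lemma perfect_plasticity_solutionP tau u : H1 = 0 -> H2 = 0 -> t0 < tau <= T ->
  ac_from t0 u0 tau u -> minus_inactive S t0 tau u ->
  solution S t0 u0 tau u <->
  rate_in S t0 [set mixed_rate S theta | theta in `[0, 1]] tau u.
Proof.
move=> H10 H20 tauT acu minus; have /andP[t0tau tau_le] := tauT; split=> [sol|rate].
  have val : valid_solution S t0 u0 tau u by [].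
  have act : {in `[t0, tau], forall t, g1 S 1 t (u t) = 0 /\ g2 S 1 t (u t) = 0}.
    by apply: hardening_active; rewrite ?H10 ?H20.
  have [[_ _ dyn] rate _ _] := solution_multipliers tauT val.
  apply: ae_onS (ae_onI dyn (ae_onI rate (active_multipliers tauT val act))) => t _.
  move=> [[dl0 [_ _ L10 _ _] [_ _ L20 _ _]] [[ut u'] [_ + _]]].
  rewrite H10 mulr0 mul0r addr0 => dlE; split=> //.
  (* [theta] is the share of spring 1 in the total [l' = L1 + L2]. *)
  exists (mixed_rate S (multiplier1 u t / dl t)).
    exists (multiplier1 u t / dl t) => //; rewrite /= in_itv /= divr_ge0 ?(ltW dl0) //=.
    by rewrite ler_pdivrMr // mul1r dlE lerDl.
  rewrite -/(combination _ _) combinationZ u' -/dl.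
  have dln : dl t != 0 by rewrite gt_eqF.
  congr combination; first by field.
  by transitivity (dl t - multiplier1 u t); [rewrite dlE; ring|field].
pose L1 t := multiplier1 u t; pose L2 t := multiplier2 u t.
have comb : ae_on t0 tau (fun t => [/\ derivable u t 1, derivable (l S) t 1,
    u^`()%classic t = combination (L1 t) (L2 t), 0 <= L1 t /\ 0 <= L2 t &
    L1 t + L2 t = dl t]).
  apply: ae_onS (ae_onI rate (ae_on_sub (lexx t0) tau_le l_increasing)) => t _.
  move=> [[ut [_ [theta /= theta01 <-] u']] [lt_ dl0]].
  rewrite -/(combination _ _) combinationZ in u'.
  have [M1 M2] := multiplier_combination u'; rewrite /L1 /L2 M1 M2 -/dl.
  move: theta01; rewrite in_itv /= => /andP[? ?].
  by split=> //; [split; rewrite mulr_ge0 ?(ltW dl0) //; lra|ring].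
have [ac1 ac2] := gap_ac 1 tau_le acu.1.
have zero (G : R -> R) (H : R) : absolutely_continuous t0 tau G -> G t0 = 0 ->
    ae_on t0 tau (fun t => derivable G t 1 /\ K * G^`()%classic t = 0) ->
    {in `[t0, tau], forall t, G t = 0}.
  move=> acG G0 ae t tin; rewrite -G0; apply: (ac_constant acG _ tin).
  apply: ae_onS ae => s _ [dG /eqP]; rewrite mulf_eq0 gt_eqF //= => /eqP.
  by split.
have rates : ae_on t0 tau (fun t =>
    (derivable (fun s => g1 S 1 s (u s)) t 1 /\
     K * (fun s => g1 S 1 s (u s))^`()%classic t = 0) /\
    (derivable (fun s => g2 S 1 s (u s)) t 1 /\
     K * (fun s => g2 S 1 s (u s))^`()%classic t = 0)).
  apply: ae_onS comb => t _ [ut lt_ u' _ LE].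
  have [[d1 e1] [d2 e2]] := gap_rate ut lt_ u'.
  by split; split=> //; [rewrite e1 H10|rewrite e2 H20]; rewrite LE; ring.
have Z1 : {in `[t0, tau], forall t, g1 S 1 t (u t) = 0}.
  apply: zero => //; first by rewrite acu.2; case: plus_active.
  by apply: ae_onS rates => t _ [].
have Z2 : {in `[t0, tau], forall t, g2 S 1 t (u t) = 0}.
  apply: zero => //; first by rewrite acu.2; case: plus_active.
  by apply: ae_onS rates => t _ [].
apply: (solution_of_multipliers (L1 := L1) (L2 := L2)) => //.
apply: ae_onS comb => t tin [ut _ u' L0 _].
by split=> //; rewrite Z1 ?Z2 ?ltxx.
Qed.

Lemma present_mixed theta : H1 = 0 -> H2 = 0 -> theta \in `[0, 1] ->
  present S t0 T u0 (mixed_rate S theta).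
Proof.
move=> H10 H20; rewrite in_itv /= => /andP[? ?]; rewrite -/(combination _ _).
have r : 1 - (theta + (1 - theta)) = 0 by ring.
by apply: present_combination; rewrite ?H10 ?H20 ?r ?mulr0 ?mul0r ?subr0 ?ltxx ?subr_ge0.
Qed.

(** * Softening: localized and distributed solutions *)

Lemma present_localized1 : H1 <= 0 -> H2 < 0 -> -1 < K * H1 ->
  present S t0 T u0 (localized_rate1 S).
Proof.
move=> H10 H20 KH1; rewrite localized_rate1E.
have d0 : 0 < 1 + K * H1 by lra.
have KH1_le : K * H1 <= 0 by rewrite mulr_ge0_le0 // ltW.
have d1 : 1 + K * H1 != 0 by rewrite gt_eqF.
have r1 : 1 - ((1 + K * H1)^-1 + 0) - K * H1 * (1 + K * H1)^-1 = 0 by field.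
(* Softening puts [1 + K * H1] between 0 and 1, so its inverse is at least 1 and the constraint of
   spring 2 is not violated. *)
have r2 : 1 - ((1 + K * H1)^-1 + 0) - K * H2 * 0 <= 0.
  by rewrite addr0 mulr0 subr0 subr_le0 invf_ge1 //; lra.
by apply: present_combination; rewrite ?r1 ?ltxx ?invr_ge0 ?(ltW d0).
Qed.

Lemma present_localized2 : H1 < 0 -> H2 <= 0 -> -1 < K * H2 ->
  present S t0 T u0 (localized_rate2 S).
Proof.
move=> H10 H20 KH2; rewrite localized_rate2E.
have d0 : 0 < 1 + K * H2 by lra.
have KH2_le : K * H2 <= 0 by rewrite mulr_ge0_le0 // ltW.
have d1 : 1 + K * H2 != 0 by rewrite gt_eqF.
have r1 : 1 - (0 + (1 + K * H2)^-1) - K * H2 * (1 + K * H2)^-1 = 0 by field.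
have r2 : 1 - (0 + (1 + K * H2)^-1) - K * H1 * 0 <= 0.
  by rewrite add0r mulr0 subr0 subr_le0 invf_ge1 //; lra.
by apply: present_combination; rewrite ?r1 ?ltxx ?invr_ge0 ?(ltW d0).
Qed.

Lemma possible_localized1 : H1 < 0 -> H2 < 0 ->
  possible S t0 T u0 (localized_rate1 S) -> -1 < K * H1.
Proof.
move=> H10 H20; rewrite localized_rate1E => /(possible_combination H10 H20)[_ _].
by rewrite addr0 invr_gt0; lra.
Qed.

Lemma possible_localized2 : H1 < 0 -> H2 < 0 ->
  possible S t0 T u0 (localized_rate2 S) -> -1 < K * H2.
Proof.
move=> H10 H20; rewrite localized_rate2E => /(possible_combination H10 H20)[_ _].
by rewrite add0r invr_gt0; lra.
Qed.

(** The sum of the multipliers is [H1 + H2] over the denominator; it must be positive, while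
    [H1 + H2] is negative. *)
Lemma possible_distributed : H1 < 0 -> H2 < 0 ->
  possible S t0 T u0 (distributed_rate S) -> distributed_den S < 0.
Proof.
move=> H10 H20; rewrite distributed_rateE => /(possible_combination H10 H20)[_ _].
by rewrite -mulrDl nmulr_rgt0 ?invr_lt0 // ltr_nDl.
Qed.

(** With [L2 = 0] the activity equation reads [l' = L1 (1 + K H1)]; as [l' > 0], the factor is
    nonzero. *)
Lemma has_rate_localized1 tau u : t0 < tau <= T -> valid_solution S t0 u0 tau u ->
  {in `[t0, tau], forall t, g1 S 1 t (u t) = 0} ->
  {in `]t0, tau], forall t, g2 S 1 t (u t) < 0} ->
  has_rate S t0 (localized_rate1 S) tau u.
Proof.
move=> tauT val act inact; have /andP[t0tau _] := tauT.
have [dyn rate _ _] := solution_multipliers tauT val.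
have r1 := gap_rates_active t0tau dyn act; case: dyn => _ _ dyn.
rewrite localized_rate1E; apply: has_rate_combination rate _.
apply: ae_onS (ae_onI dyn (ae_onI r1 (ae_on_oo t0 tau))) => t _.
move=> [[dl0 _ [_ _ _ _ c2]] [e1 /andP[tt ttau]]].
have L20 : multiplier2 u t = 0 by apply/c2/inact; rewrite in_itv /= tt ltW.
have e : dl t = multiplier1 u t * (1 + K * H1) by rewrite e1 L20; ring.
have d0 : 1 + K * H1 != 0.
  by apply/eqP => d0; move: dl0; rewrite e d0 mulr0 ltxx.
by rewrite L20 mulr0 e mulfK.
Qed.

Lemma has_rate_localized2 tau u : t0 < tau <= T -> valid_solution S t0 u0 tau u ->
  {in `[t0, tau], forall t, g2 S 1 t (u t) = 0} ->
  {in `]t0, tau], forall t, g1 S 1 t (u t) < 0} ->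
  has_rate S t0 (localized_rate2 S) tau u.
Proof.
move=> tauT val act inact; have /andP[t0tau _] := tauT.
have [dyn rate _ _] := solution_multipliers tauT val.
have r2 := gap_rates_active t0tau (gap_dynamicsC dyn) act; case: dyn => _ _ dyn.
rewrite localized_rate2E; apply: has_rate_combination rate _.
apply: ae_onS (ae_onI dyn (ae_onI r2 (ae_on_oo t0 tau))) => t _.
move=> [[dl0 [_ _ _ _ c1] _] [e2 /andP[tt ttau]]].
have L10 : multiplier1 u t = 0 by apply/c1/inact; rewrite in_itv /= tt ltW.
have e : dl t = multiplier2 u t * (1 + K * H2) by rewrite e2 L10; ring.
have d0 : 1 + K * H2 != 0.
  by apply/eqP => d0; move: dl0; rewrite e d0 mulr0 ltxx.
by rewrite L10 mulr0 e mulfK.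
Qed.

Lemma valid_solution_sub tau tau' u : tau' <= tau ->
  valid_solution S t0 u0 tau u -> valid_solution S t0 u0 tau' u.
Proof.
move=> le [[[acu ut0] sol] minus]; split; first split.
- by split=> //; exact: ac_sub (lexx t0) le acu.
- exact: ae_on_sub (lexx t0) le sol.
- by move=> t; rewrite in_itv /= => /andP[tt ttau]; apply: minus; rewrite in_itv /=; lra.
Qed.

(** The trichotomy of the gaps, read in terms of rates; only the distributed case shortens the
    interval. *)
Lemma softening_initial_rate tau u : H1 < 0 -> H2 < 0 -> t0 < tau <= T ->
  valid_solution S t0 u0 tau u ->
  exists2 tau', t0 < tau' <= tau &
    [\/ has_rate S t0 (localized_rate1 S) tau' u,
        has_rate S t0 (localized_rate2 S) tau' u |
        has_rate S t0 (distributed_rate S) tau' u].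
Proof.
move=> H10 H20 tauT val; have /andP[t0tau tau_le] := tauT.
have [dyn _ G1t0 G2t0] := solution_multipliers tauT val.
have [[z n]|[z n]|[c cT z]] :=
  gap_softening_trichotomy K_gt0 H10 H20 t0tau G1t0 G2t0 dyn.
- exists tau; first by rewrite t0tau lexx.
  by apply: Or31; exact: has_rate_localized1.
- exists tau; first by rewrite t0tau lexx.
  by apply: Or32; exact: has_rate_localized2.
- exists c => //; apply: Or33; have /andP[t0c ctau] := cT.
  apply: has_rate_distributed z; rewrite ?lt_eqF //; first lra.
  exact: valid_solution_sub val.
Qed.

Lemma possible_of_valid v tau u : t0 < tau <= T -> valid_solution S t0 u0 tau u ->
  has_rate S t0 v tau u -> possible S t0 T u0 v.
Proof. by exists tau, u. Qed.

Lemma softening_branches : H1 < 0 -> H2 < 0 ->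
  [/\ branch_at_start S t0 T u0 (localized_rate1 S) (localized_rate2 S),
      branch_at_start S t0 T u0 (localized_rate1 S) (distributed_rate S) &
      branch_at_start S t0 T u0 (localized_rate2 S) (distributed_rate S)].
Proof.
move=> H10 H20.
(* Because the inverse of 0 is 0, rates with degenerate denominators could coincide. Distinctness is
   therefore shown only for possible rates, by a multiplier that is 0 in one and nonzero in the
   other. *)
have branch v w :
    (possible S t0 T u0 v -> possible S t0 T u0 w -> v <> w) ->
    branch_at_start S t0 T u0 v w.
  move=> vw tau u x tauT valu ru valx rx.
  apply: (branch_neq _ tauT valu ru valx rx); apply: vw.
    exact: possible_of_valid valu ru.
  exact: possible_of_valid valx rx.
split; apply: branch.
- move=> /(possible_localized1 H10 H20) p _.
  rewrite localized_rate1E localized_rate2E => /combination_inj[/eqP].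
  by rewrite invr_eq0 gt_eqF //; lra.
- move=> _ /(possible_distributed H10 H20) d.
  rewrite localized_rate1E distributed_rateE => /combination_inj[_ /esym/eqP].
  by rewrite mulf_eq0 invr_eq0 !lt_eqF.
- move=> _ /(possible_distributed H10 H20) d.
  rewrite localized_rate2E distributed_rateE => /combination_inj[/esym/eqP].
  by rewrite mulf_eq0 invr_eq0 !lt_eqF.
Qed.

End Rates.

(** * Assembly of the cases by the sign of [1 - h_i] *)

Theorem proposition5p1 (R : realType) (S : two_springs R) (t0 T : R)
    (u0 : 'cV[R]_3)
    (ht : t0 < T)
    (hk : 0 < k1 S /\ 0 < k2 S)
    (hs : 0 < s1 S /\ 0 < s2 S)
    (hc : 0 < c01 S /\ 0 < c02 S)
    (hlip : [lipschitz (l S) t | t in `[t0, T]])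
    (hl0 : l S t0 = 0)
    (hl' : ae_on t0 T (fun t => derivable (l S) t 1 /\ 0 < (l S)^`()%classic t))
    (hf2 : ae_on t0 T (fun t => f2 S t = 0))
    (hplus : g1 S 1 t0 u0 = 0 /\ g2 S 1 t0 u0 = 0)
    (hminus : g1 S (-1) t0 u0 < 0 /\ g2 S (-1) t0 u0 < 0) :
  (* A *)
  (h1 S < 1 -> h2 S < 1 ->
    [/\ present S t0 T u0 (distributed_rate S),
        forall tau u, t0 < tau <= T -> valid_solution S t0 u0 tau u ->
          has_rate S t0 (distributed_rate S) tau u &
        forall tau u x, t0 < tau <= T ->
          valid_solution S t0 u0 tau u -> valid_solution S t0 u0 tau x ->
          {in `[t0, tau], u =1 x}]) /\
  (* B *)
  (h1 S = 1 -> h2 S = 1 ->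
    [/\ forall theta, theta \in `[0, 1] ->
          present S t0 T u0 (mixed_rate S theta),
        forall theta theta', theta \in `[0, 1] -> theta' \in `[0, 1] ->
          theta != theta' ->
          branch_at_start S t0 T u0 (mixed_rate S theta) (mixed_rate S theta') &
        forall tau u, t0 < tau <= T ->
          ac_from t0 u0 tau u -> minus_inactive S t0 tau u ->
          solution S t0 u0 tau u <->
          rate_in S t0 [set mixed_rate S theta | theta in `[0, 1]] tau u]) /\
  (* C *)
  (1 < h1 S -> 1 < h2 S ->
    [/\ present_iff S t0 T u0 (localized_rate1 S)
          (-1 < ((k1 S)^-1 + (k2 S)^-1) * (1 - h1 S) * s1 S ^+ 2),
        present_iff S t0 T u0 (localized_rate2 S)
          (-1 < ((k1 S)^-1 + (k2 S)^-1) * (1 - h2 S) * s2 S ^+ 2),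
        present_iff S t0 T u0 (distributed_rate S) (distributed_den S < 0),
        [/\ branch_at_start S t0 T u0 (localized_rate1 S) (localized_rate2 S),
            branch_at_start S t0 T u0 (localized_rate1 S) (distributed_rate S) &
            branch_at_start S t0 T u0 (localized_rate2 S) (distributed_rate S)] &
        (* every solution starts as one of the three; since a distributed
           solution may localize later, this can only hold near t0 *)
        forall tau u, t0 < tau <= T -> valid_solution S t0 u0 tau u ->
          exists2 tau', t0 < tau' <= tau &
            [\/ has_rate S t0 (localized_rate1 S) tau' u,
                has_rate S t0 (localized_rate2 S) tau' u |
                has_rate S t0 (distributed_rate S) tau' u]]).
Proof.
have [s10 s20] := hs.
have stiff1 : h1 S < 1 -> 0 < (1 - h1 S) * s1 S ^+ 2.
  by move=> ?; rewrite mulr_gt0 ?exprn_gt0 ?subr_gt0.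
have stiff2 : h2 S < 1 -> 0 < (1 - h2 S) * s2 S ^+ 2.
  by move=> ?; rewrite mulr_gt0 ?exprn_gt0 ?subr_gt0.
have soft1 : 1 < h1 S -> (1 - h1 S) * s1 S ^+ 2 < 0.
  by move=> ?; rewrite pmulr_llt0 ?exprn_gt0 ?subr_lt0.
have soft2 : 1 < h2 S -> (1 - h2 S) * s2 S ^+ 2 < 0.
  by move=> ?; rewrite pmulr_llt0 ?exprn_gt0 ?subr_lt0.
split; [|split].
- move=> /stiff1 H1 /stiff2 H2.
  have den : 0 < distributed_den S.
    have [k10 k20] := hk; rewrite distributed_denE.
    have K0 : 0 < (k1 S)^-1 + (k2 S)^-1 by rewrite addr_gt0 ?invr_gt0.
    exact: addr_gt0 (addr_gt0 H1 H2) (mulr_gt0 (mulr_gt0 K0 H1) H2).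
  have rate tau u : t0 < tau <= T -> valid_solution S t0 u0 tau u ->
      has_rate S t0 (distributed_rate S) tau u.
    move=> tauT val; apply: (has_rate_distributed (T := T) (u0 := u0)) => //.
      by rewrite gt_eqF.
    by apply: (hardening_active (T := T) (u0 := u0)) => //; exact: ltW.
  split=> //.
    by apply: present_distributed;
      rewrite // ?(gt_eqF den) // divr_ge0 ?(ltW den) ?(ltW H1) ?(ltW H2).
  (* Uniqueness: both solutions have the distributed rate, hence equal the same function
     [u0 + l(t) v]. *)
  move=> tau u x tauT valu valx t tin.
  rewrite (has_rate_line hlip hl0 hl' tauT valu.1.1 (rate _ _ tauT valu) tin).
  by rewrite (has_rate_line hlip hl0 hl' tauT valx.1.1 (rate _ _ tauT valx) tin).
- move=> h11 h21.
  have H1 : (1 - h1 S) * s1 S ^+ 2 = 0 by rewrite h11 subrr mul0r.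
  have H2 : (1 - h2 S) * s2 S ^+ 2 = 0 by rewrite h21 subrr mul0r.
  split.
  + by move=> theta; apply: present_mixed.
  + move=> theta theta' _ _ neq; apply: branch_neq => //.
    by move=> /(combination_inj hs)[E _]; rewrite E eqxx in neq.
  + by move=> tau u tauT acu minus; exact: (perfect_plasticity_solutionP (T := T)).
(* Reassociation exhibits the factors [(1 - h_i) s_i^2] in which the lemmas are stated. *)
- move=> /soft1 H1 /soft2 H2; rewrite -!mulrA; split.
  + split; first by apply: present_localized1 => //; exact: ltW.
    exact: possible_localized1.
  + split; first by apply: present_localized2 => //; exact: ltW.
    exact: possible_localized2.
  + split=> [den|]; last exact: possible_distributed.
    by apply: present_distributed;
      rewrite // ?(lt_eqF den) // mulr_le0 ?invr_le0 ?(ltW den) ?(ltW H1) ?(ltW H2).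
  + exact: (softening_branches (T := T) (u0 := u0)).
  + by move=> tau u; apply: softening_initial_rate.
Qed.
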